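(* Let $d\geq 3$ and let $\{p_n\}_{n\in\mathbb{N}}$ be a sequence in $[0,1]$ with $\sum_{n=1}^{\infty}p_n=\infty$. Consider the long-range oriented percolation process with random letters on $\mathbb{G}^d_+$. Then for all $p\in(0,1)$, $\epsilon\in(0,1]$ and $\alpha>0$, there exists $K=K(\{p_n\},p,\epsilon,\alpha)\in\mathbb{N}$ large enough such that $$\mathbb{P}_{p,\epsilon}^K(W_0=\Xi)>1-\alpha .$$
   Context: $\mathbb{N}=\{1,2,\dots\}$ and $\mathbb{Z}_+=\{0,1,2,\dots\}$. Let $(\mathbf{e}_1,\dots,\mathbf{e}_d)$ be the canonical basis of $\mathbb{R}^d$. $\mathbb{G}^d_+$ is the oriented graph with vertex set $\mathbb{Z}_+^d$ whose oriented edges are the vertical edges $\langle u,u+n\mathbf{e}_d\rangle$ ($u\in\mathbb{Z}_+^d$, $n\in\mathbb{N}$; such an edge has length $n$) and the horizontal edges $\langle u,u+\mathbf{e}_i\rangle$ ($u\in\mathbb{Z}_+^d$, $1\leq i\leq d-1$; length $1$). An edge $\langle u,v\rangle$ may be traversed only from $u$ to $v$. Letters: each vertex $v$ receives a random letter $X(v)\in\{0,1\}$ with $X(v)=1$ with probability $p$ and $X(v)=0$ with probability $1-p$. $K$-truncated bond configuration: each edge $e$ receives a random variable $Y(e)\in\{0,1\}$; $e$ is open if $Y(e)=1$. A horizontal edge is open with probability $\epsilon$; a vertical edge of length $n$ is open with probability $p_n$ if $n\leq K$ and with probability $0$ if $n>K$. $\mathbb{P}_{p,\epsilon}^K$ is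 the joint law under which all the variables $X(v)$ and $Y(e)$ are independent with these distributions. Words: $\Xi=\{0,1\}^{\mathbb{N}}$. A word $\xi=(\xi_1,\xi_2,\dots)\in\Xi$ is seen from the vertex $v$ (in the $K$-truncated model) if there is a sequence of pairwise distinct vertices $v=v_0,v_1,v_2,\dots$ of $\mathbb{Z}_+^d$ such that, for every $i\geq1$, $\langle v_{i-1},v_i\rangle$ is an oriented edge of $\mathbb{G}^d_+$ of length at most $K$ which is open, and $X(v_i)=\xi_i$ (the letter at $v_0=v$ plays no role). $W_0$ is the (random) set of all words $\xi\in\Xi$ seen from the origin $0\in\mathbb{Z}_+^d$. *)

(* Defs.v *)
From HB Require Import structures.
From mathcomp Require Import all_boot all_order all_algebra finmap.
From mathcomp Require Import all_classical all_reals all_analysis.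

Set Implicit Arguments.
Unset Strict Implicit.
Unset Printing Implicit Defensive.

Import Order.TTheory GRing.Theory Num.Theory.
Import numFieldNormedType.Exports.

Local Open Scope classical_set_scope.
Local Open Scope ring_scope.

Definition vertex (d : nat) := 'rV[nat]_d.

(* Coordinates are numbered from 0: [basis d i] is the usual e_(i+1), so the
   vertical direction e_d is [basis d d.-1] and the horizontal directions are
   the [basis d i] with [i : 'I_d.-1]. *)
Definition basis (d i : nat) : vertex d := \row_(j < d) (j == i :> nat : nat).

Definition posnat := {n : nat | (0 < n)%N}.

(* [inl (u, i)] is the horizontal edge <u, u + basis d i>, and [inr (u, n)] the
   vertical edge <u, u + n e_d>. *)
Definition edge (d : nat) : Type := (vertex d * 'I_d.-1) + (vertex d * posnat).

Definition source (d : nat) (e : edge d) : vertex d :=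
  match e with inl (u, _) => u | inr (u, _) => u end.

Definition target (d : nat) (e : edge d) : vertex d :=
  match e with
  | inl (u, i) => u + basis d i
  | inr (u, n) => u + basis d d.-1 *+ val n
  end.

Definition edge_length (d : nat) (e : edge d) : nat :=
  match e with inl _ => 1%N | inr (_, n) => val n end.

(* Only [pn n] with n >= 1 is ever used. *)
Definition open_prob (R : realType) (d : nat) (eps : R) (pn : nat -> R)
    (K : nat) (e : edge d) : R :=
  match e with
  | inl _ => eps
  | inr (_, n) => if (val n <= K)%N then pn (val n) else 0
  end.

Definition mutually_independent (disp disp' : measure_display)
    (T : measurableType disp) (T' : measurableType disp') (R : realType)
    (P : probability T R) (I : choiceType) (Z : I -> {RV P >-> T'}) : Prop :=
  forall (J : {fset I}) (B : I -> set T'),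
    (forall i, i \in J -> measurable (B i)) ->
    P (\bigcap_(i in [set` J]) (Z i @^-1` B i)) =
    (\prod_(i <- J) P (Z i @^-1` B i))%E.

Definition letters_and_bonds (disp : measure_display) (T : measurableType disp)
    (R : realType) (P : probability T R) (d : nat)
    (X : vertex d -> {RV P >-> bool}) (Y : edge d -> {RV P >-> bool})
    (a : vertex d + edge d) : {RV P >-> bool} :=
  match a with inl v => X v | inr e => Y e end.

(* Under [P], the family (X, Y) has the joint law P_{p,eps}^K. *)
Definition truncated_model (disp : measure_display) (T : measurableType disp)
    (R : realType) (P : probability T R) (d : nat) (p eps : R) (pn : nat -> R)
    (K : nat) (X : vertex d -> {RV P >-> bool})
    (Y : edge d -> {RV P >-> bool}) : Prop :=
  [/\ mutually_independent (letters_and_bonds X Y),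
      forall v, P (X v @^-1` [set true]) = p%:E
    & forall e, P (Y e @^-1` [set true]) = (open_prob eps pn K e)%:E].

(* Words are indexed from 0: [xi i] is the letter usually written xi_(i+1). *)
Definition word := nat -> bool.

Definition seen_from (d K : nat) (x : vertex d -> bool) (y : edge d -> bool)
    (v : vertex d) (xi : word) : Prop :=
  exists s : nat -> vertex d,
    [/\ s 0%N = v, injective s
      & forall i : nat,
          (exists e : edge d,
             [/\ source e = s i, target e = s i.+1,
                 (edge_length e <= K)%N & y e]) /\
          x (s i.+1) = xi i].

Definition W0 (d K : nat) (x : vertex d -> bool) (y : edge d -> bool) :
    set word :=
  [set xi | seen_from K x y 0 xi].

(* Main.v *)
Require Import Defs.
From HB Require Import structures.
From mathcomp Require Import all_boot all_order all_algebra finmap.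
From mathcomp Require Import all_classical all_reals all_analysis.
From mathcomp Require Import zify ring lra.

Set Implicit Arguments.
Unset Strict Implicit.
Unset Printing Implicit Defensive.

Import Order.TTheory GRing.Theory Num.Theory.
Import numFieldNormedType.Exports.

Local Open Scope classical_set_scope.
Local Open Scope ring_scope.

(** The construction follows one word at a time.  A path is advanced by pairs
    of steps: a vertical jump, then a horizontal step in one of two fixed
    directions.  Each pair leads from the column of vertices above a site (i, j)
    of the quarter plane to the column above (i+1, j) or (i, j+1).  As the p_n
    have infinite sum, for K large a vertex has with probability close to 1, in
    both directions, at least L jumps that land on the required letter and are
    followed by an open horizontal edge.  They offer L candidates in the
    next column, one of which carries the next letter with probability close
    to 1.  The path takes the lowest such candidate: the letters inspected in
    this column then lie at most as high as the chosen vertex, so everything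
    used to leave it is still unrevealed.  Hence a site that is entered
    fails with conditional probability at most [delta], and since distinct
    columns carry independent variables, k given sites all fail with probability
    at most delta ^ k ([mean_failed], [mean_all_failed]).

    If the word is not seen, the set of sites where the exploration succeeds is
    finite.  Its boundary circuit through the origin, of length N say, passes at
    least N / 4 distinct sites that failed after having been entered
    ([contour]).  These sites lie within distance 2 N of the origin, so their
    failures involve the first 4 N + 1 letters only: although there are
    uncountably many words, only 2 ^ (4 N + 1) prefixes matter for circuits of
    length N.  There are at most 3 ^ N circuits, and the sum over N of
    2 ^ (4 N + 1) * 3 ^ N * delta ^ (N / 4) is small when delta is small
    ([scenarios_sum], [obstructed_prob]).  This trade between the depth at which
    a word dies and the size of the obstruction needs two horizontal directions,
    whence d >= 3.

    Paths are oriented and the truncated graph is locally finite, so by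
    compactness all words are seen as soon as all finite words are
    ([W0_fullP]); this gives measurability and reduces the probability of the
    event to a limit of probabilities about words of length n.

    Probabilities of events about finitely many variables are computed by an
    iterated average over their coordinates, [mean]; [transfer] identifies it
    with the probability. *)

(** * Boundary circuits in the plane *)

Section Contour.

Definition cell := (int * int)%type.
(** A pair (r, e) stands for the side of the cell r facing its neighbour r + e.
    The side is walked with r on the right hand and r + e on the left hand. *)
Definition side := (cell * cell)%type.

(** A quarter turn clockwise: the direction of travel along the side (r, e) is
    [quarter e]. *)
Definition quarter (e : cell) : cell := (e.2, - e.1).
Definition outer_cell (s : side) : cell := s.1 + s.2.

(** The next side of a circuit is one of three, according to whether the walk
    turns right, goes straight on or turns left; a circuit is thus coded by a
    word on three symbols. *)
Definition advance (s : side) (t : 'I_3) : side :=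
  let u := quarter s.2 in
  if val t == 0%N then (s.1, u)
  else if val t == 1%N then (s.1 + u, s.2)
  else (s.1 + u + s.2, - u).

Fixpoint trace (s : side) (ts : seq 'I_3) : seq side :=
  if ts is t :: ts' then s :: trace (advance s t) ts' else [::].

Definition origin_side : side := ((0, 0), (-1, 0)).

(** Holds for the unit vectors (0, 1) and (1, 0): the outer cell can then be
    entered from r by an oriented step of the quarter plane. *)
Definition forward (s : side) : bool := s.2.1 + s.2.2 == 1.

Definition abs_cell (c : cell) : nat * nat := (`|c.1|%N, `|c.2|%N).

(** The sites just outside the circuit that an oriented step could have
    entered; they depend on the turns alone, not on the set of cells that is
    encircled. *)
Definition blocking (ts : seq 'I_3) : seq (nat * nat) :=
  undup [seq abs_cell (outer_cell s) | s <- trace origin_side ts & forward s].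

Definition units : seq cell := [:: (0, 1); (1, 0); (0, -1); (-1, 0)].

Section Follow.
Variable C : pred cell.

(** At a corner where four cells meet alternately inside and outside, the walk
    turns right, so that it keeps to the same cell. *)
Definition turn (s : side) : 'I_3 :=
  let u := quarter s.2 in
  if ~~ C (s.1 + u) then @Ordinal 3 0 isT
  else if ~~ C (s.1 + u + s.2) then @Ordinal 3 1 isT else @Ordinal 3 2 isT.

Definition follow (s : side) : side := advance s (turn s).

Definition on_boundary (s : side) : bool :=
  [&& C s.1, ~~ C (outer_cell s) & s.2 \in units].

Lemma followE s : follow s = let u := quarter s.2 in
  if ~~ C (s.1 + u) then (s.1, u)
  else if ~~ C (s.1 + u + s.2) then (s.1 + u, s.2)
  else (s.1 + u + s.2, - u).
Proof.
rewrite /follow /advance /turn /=; case: (~~ C (_ + quarter _)) => //=.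
by case: (~~ C _).
Qed.

Lemma quarter_unit e : e \in units -> quarter e \in units.
Proof. by rewrite !inE => /or4P[] /eqP->. Qed.

Lemma opp_unit (e : cell) : e \in units -> - e \in units.
Proof. by rewrite !inE => /or4P[] /eqP->. Qed.

Lemma follow_boundary s : on_boundary s -> on_boundary (follow s).
Proof.
case: s => r e /and3P[/= Cr Cl eu]; rewrite followE /on_boundary /outer_cell /=.
case: ifP => /= [->|/negbFE Cu]; first by rewrite Cr quarter_unit.
case: ifP => /= [->|/negbFE ->]; first by rewrite Cu eu.
rewrite opp_unit ?quarter_unit // andbT.
by rewrite addrAC addrK.
Qed.

Definition follow_back (s : side) : side :=
  let u := quarter s.2 in
  if ~~ C (s.1 - u) then (s.1, - u)
  else if ~~ C (s.1 - u + s.2) then (s.1 - u, s.2)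
  else (s.1 - u + s.2, u).

(** Running the boundary backwards obeys the mirror rule: the three cases of
    [follow] leave different traces around the new side. *)
Lemma followK s : on_boundary s -> follow_back (follow s) = s.
Proof.
case: s => r e /and3P[/= Cr Cl _]; rewrite /outer_cell /= in Cl.
have qq x : quarter (quarter x) = - x by case: x.
have qN x : quarter (- x) = - quarter x by [].
rewrite followE /=; case: ifP => [Cu|/negbFE Cu].
  by rewrite /follow_back /= qq opprK Cl.
case: ifP => [Cue|/negbFE Cue]; rewrite /follow_back /=.
  by rewrite addrK Cr /= Cl.
by rewrite qN qq opprK addrK Cu /= addrK Cr /= opprK.
Qed.

Lemma follow_inj s t : on_boundary s -> on_boundary t ->
  follow s = follow t -> s = t.
Proof. by move=> bs bt E; rewrite -(followK bs) E followK. Qed.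

Lemma trace_follow n s :
  trace s [seq turn x | x <- traject follow s n] = traject follow s n.
Proof. by elim: n s => //= n IH s; rewrite IH. Qed.

(** The coordinate x - y of the corner where the side begins.  It grows by 1
    along each forward side and drops by 1 along each other side, so a closed
    circuit has as many forward sides as others. *)
Definition height_gap (s : side) : int := s.1.1 - s.1.2 - s.2.2.

Lemma height_gap_follow s :
  height_gap (follow s) = height_gap s + (s.2.1 + s.2.2).
Proof.
rewrite followE /height_gap; case: s => [[a b] [c d]] /=.
by case: ifP => _; [|case: ifP => _]; rewrite /= /quarter /=; ring.
Qed.

Lemma iter_boundary s n : on_boundary s -> on_boundary (iter n follow s).
Proof. by move=> bs; elim: n => //= n; apply: follow_boundary. Qed.

Lemma height_gap_iter s n : on_boundary s ->
  height_gap (iter n follow s) + n%:Z =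
  height_gap s + (count forward (traject follow s n)).*2%:Z.
Proof.
move=> bs; elim: n => [|n IH]; first by rewrite /= addr0.
rewrite trajectSr -cats1 count_cat /= height_gap_follow.
have /and3P[_ _] := iter_boundary n bs.
move: (iter n follow s) IH => [r e] /= IH eu.
have -> : forward (r, e) = (e.1 + e.2 == 1) by [].
move: (height_gap _) (height_gap _) (count _ _) IH => x y z IH.
by move: eu; rewrite !inE => /or4P[] /eqP -> /=; lia.
Qed.

(** An injective map with finitely many possible values first repeats itself at
    its starting point. *)
Lemma follow_cycle (D : seq cell) s : {subset C <= D} -> on_boundary s ->
  exists n, [/\ (0 < n)%N, iter n follow s = s,
    uniq (traject follow s n) & (n <= 4 * size D)%N].
Proof.
move=> CD bs; pose T := [seq (r, e) | r <- D, e <- units].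
have sT n : {subset traject follow s n <= T}.
  move=> x /trajectP[i _ ->]; have := iter_boundary i bs.
  move: (iter i follow s) => [r e] /and3P[/= Cr _ eu].
  by apply/allpairsP; exists (r, e); split => //; apply: CD.
have szT : size T = (4 * size D)%N by rewrite size_allpairs mulnC.
have exL : exists n, looping follow s n.
  exists (size T); apply/negPn/negP; rewrite -looping_uniq => /uniq_leq_size.
  by move=> /(_ _ (sT _)); rewrite size_traject ltnn.
case: (ex_minnP exL) => -[//|n] Ln min.
have un : uniq (traject follow s n.+1).
  by rewrite looping_uniq; apply/negP => /min; rewrite ltnn.
exists n.+1; split => //; last first.
  by rewrite -szT -(size_traject follow s n.+1); apply: uniq_leq_size.
case/trajectP: Ln => -[//|i] lin /= /follow_inj Ei.
have {}Ei : iter n follow s = iter i follow s.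
  by apply: Ei; apply: iter_boundary.
suff /min : looping follow s n by rewrite ltnn.
by apply/trajectP; exists i.
Qed.

End Follow.

(** A turn displaces the inner cell by at most 2. *)
Lemma outer_level s ts x : s.2 \in units -> x \in trace s ts ->
  (`|(outer_cell x).1| + `|(outer_cell x).2| <=
   `|s.1.1| + `|s.1.2| + (size ts).*2)%N.
Proof.
have qu e : e \in units ->
    (`|e.1| + `|e.2| = 1)%N /\ (`|(quarter e).1| + `|(quarter e).2| = 1)%N.
  by rewrite !inE => /or4P[] /eqP->.
have triang (a b : int) : (absz (a + b)%R <= absz a + absz b)%N by lia.
have addE (a b : cell) :
    (absz (a + b)%R.1 + absz (a + b)%R.2 <=
     absz a.1 + absz a.2 + (absz b.1 + absz b.2))%N.
  rewrite -[(a + b).1]/(a.1 + b.1) -[(a + b).2]/(a.2 + b.2).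
  by rewrite addnACA leq_add.
elim: ts s => [//|t ts IH] s eu /=; rewrite inE => /predU1P[->|].
  by apply: leq_trans (addE _ _) _; rewrite (qu _ eu).1 leq_add2l doubleS.
have mu : (advance s t).2 \in units.
  by rewrite /advance; case: ifP => _; [|case: ifP => _] => //=; rewrite ?opp_unit ?quarter_unit.
move=> /(IH _ mu) /leq_trans; apply.
rewrite doubleS -[(size ts).*2.+2]addn2 addnA [X in (_ <= X)%N]addnAC leq_add2r.
have step (a b : cell) : b \in units ->
   (absz (a + b)%R.1 + absz (a + b)%R.2 <= absz a.1 + absz a.2 + 1)%N.
  move=> H; apply: leq_trans (addE _ _) _; rewrite leq_add2l.
  by case: a b H => [? ?] [b1 b2]; rewrite !inE => /or4P[] /eqP[] -> ->.
rewrite /advance; case: ifP => _; [|case: ifP => _] => /=.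
- by rewrite leq_addr.
- by apply: leq_trans (step s.1 (quarter s.2) _) _; rewrite ?quarter_unit ?eu ?leq_add2l.
- apply: leq_trans (step (s.1 + quarter s.2) s.2 _) _; rewrite ?eu // -[2%N]/(1 + 1)%N addnA leq_add2r.
  by apply: (step s.1 _); rewrite quarter_unit.
Qed.

(** Half of the sides of the circuit are forward.  A cell has only two sides
    of this kind that face it, so a quarter of the length bounds the number of
    distinct blocking sites from below. *)
Lemma contour (C : pred cell) (D : seq cell) :
  {subset C <= D} -> (forall c, C c -> 0 <= c.1 /\ 0 <= c.2) -> C (0, 0) ->
  exists ts : seq 'I_3,
  [/\ (0 < size ts <= 4 * size D)%N, (size ts <= 4 * size (blocking ts))%N
    & {in blocking ts, forall b : nat * nat, ~~ C (b.1%:Z, b.2%:Z) /\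
       (C (b.1%:Z - 1, b.2%:Z) \/ C (b.1%:Z, b.2%:Z - 1))}].
Proof.
move=> CD Cpos C0.
have bs : on_boundary C origin_side.
  rewrite /on_boundary C0 /=; apply/andP; split => //.
  by apply/negP => /Cpos[].
have [n [n0 cyc un nD]] := follow_cycle CD bs.
exists [seq turn C x | x <- traject (follow C) origin_side n].
rewrite size_map size_traject n0 nD /blocking trace_follow.
set S := traject _ _ _ in un *.
have SP x : x \in S -> on_boundary C x.
  by move=> /trajectP[i _ ->]; apply: iter_boundary.
have half : n = (count forward S).*2.
  by have := height_gap_iter n bs; rewrite cyc => /addrI []. 
split=> //; last first.
  move=> b; rewrite mem_undup => /mapP[s]; rewrite mem_filter => /andP[fs sS ->].
  have /and3P[] := SP _ sS; move: fs; rewrite /forward /outer_cell.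
  case: s {sS} => [[a b'] e] /= fs Cr Cl eu.
  have [/= a0 b0] := Cpos _ Cr.
  move: eu fs Cl; rewrite !inE => /or4P[] /eqP -> //= _; rewrite /abs_cell /=.
    rewrite -[(a, b') + (0, 1)]/(a + 0, b' + 1) addr0.
    rewrite !gez0_abs ?addr_ge0 // => Cl.
    by split=> //; right; rewrite addrK.
  rewrite -[(a, b') + (1, 0)]/(a + 1, b' + 0) addr0.
  rewrite !gez0_abs ?addr_ge0 // => Cl.
  by split=> //; left; rewrite addrK.
(* Among sides with the same outward direction, the outer cell determines the
   side. *)
pose A e := [seq s <- S | s.2 == e].
have cnt : count forward S = (size (A (0, 1)%R) + size (A (1, 0)%R))%N.
  rewrite !size_filter -count_predUI -[LHS]addn0; congr addn.
    apply: eq_in_count => s /SP/and3P[_ _]; rewrite /forward /=.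
    by case: s => [r e] /=; rewrite !inE => /or4P[] /eqP->.
  rewrite (@eq_count _ _ pred0) ?count_pred0 // => -[r e] /=.
  by apply/negP => /andP[/eqP-> ].
have key e : e \in [:: (0, 1)%R; (1, 0)%R] ->
    (size (A e) <= size (undup [seq abs_cell (outer_cell s) | s <- S & forward s]))%N.
  move=> ee; rewrite -(size_map (fun s => abs_cell (outer_cell s))).
  apply: uniq_leq_size.
    rewrite map_inj_in_uniq ?filter_uniq // => -[r1 e1] [r2 e2].
    rewrite !mem_filter => /andP[/= /eqP -> /SP /and3P[/= /Cpos[p1 p2] _ _]].
    move=> /andP[/= /eqP -> /SP /and3P[/= /Cpos[p3 p4] _ _]].
    case: r1 r2 p1 p2 p3 p4 => [a b] [a' b'] /= p1 p2 p3 p4.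
    by move: ee; rewrite !inE /abs_cell /= => /orP[] /eqP -> /= [] h1 h2;
       do 2 f_equal; lia.
  move=> y /mapP[s]; rewrite mem_filter => /andP[/eqP es sS ->].
  rewrite mem_undup; apply/mapP; exists s => //; rewrite mem_filter sS andbT.
  by move: ee; rewrite /forward es !inE => /orP[] /eqP->.
have k1 := key (0, 1) isT; have k2 := key (1, 0) isT.
rewrite {1}half cnt; move: (size (undup _)) k1 k2 => u k1 k2.
by move: (size (A _)) (size (A _)) k1 k2 => a b; lia.
Qed.

End Contour.
(** * Averaging over independent bits *)

Section Averaging.
Variables (R : realFieldType) (I : choiceType) (q : I -> R).
Hypothesis q01 : forall i, 0 <= q i <= 1.

Implicit Types (w : I -> bool) (f g : (I -> bool) -> R) (l : seq I)
  (A : pred I) (E : (I -> bool) -> bool).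

Definition upd w i b : I -> bool := fun j => if j == i then b else w j.

(** The conditional expectation of f given all coordinates other than i, when
    the coordinate i is true with probability [q i]. *)
Definition avg i f w : R :=
  q i * f (upd w i true) + (1 - q i) * f (upd w i false).

Definition mean l f : (I -> bool) -> R := foldr avg f l.

Definition depends (T : Type) A (f : (I -> bool) -> T) :=
  forall w w', (forall i, A i -> w i = w' i) -> f w = f w'.

Definition ind E w : R := (E w)%:R.

Lemma dependsW (T : Type) A B (f : (I -> bool) -> T) :
  {subset A <= B} -> depends A f -> depends B f.
Proof. by move=> AB fA w w' H; apply: fA => i /AB/H. Qed.

Lemma depends_ind A E : depends A E -> depends A (ind E).
Proof. by move=> H w w' /H; rewrite /ind => ->. Qed.

Lemma upd_out (T : Type) A (f : (I -> bool) -> T) i b w : depends A f ->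
  ~~ A i -> f (upd w i b) = f w.
Proof.
by move=> fA nAi; apply: fA => j Aj; rewrite /upd; case: eqP Aj nAi => // -> ->.
Qed.

Lemma mean_cat l1 l2 f : mean (l1 ++ l2) f = mean l1 (mean l2 f).
Proof. by rewrite /mean foldr_cat. Qed.

Lemma avg_ext i f g w : f =1 g -> avg i f w = avg i g w.
Proof. by move=> fg; rewrite /avg !fg. Qed.

Lemma mean_ext l f g : f =1 g -> mean l f =1 mean l g.
Proof. by move=> fg; elim: l => [|i l IH] //= w; apply: avg_ext. Qed.

(** While the coordinates of l are averaged out, all others keep the values they
    have in w, and the comparison may use them. *)
Lemma mean_le_off l f g w :
  (forall w', (forall i, i \notin l -> w' i = w i) -> f w' <= g w') ->
  mean l f w <= mean l g w.
Proof.
elim: l w => [|i l IH] w fg /=; first exact: fg.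
have /andP[q0 q1] := q01 i.
rewrite /avg lerD // ler_wpM2l ?subr_ge0 //; apply: IH => w' ww'; apply: fg => j;
  by rewrite inE negb_or => /andP[/negbTE ij /ww' ->]; rewrite /upd ij.
Qed.

Lemma mean_le l f g w : (forall w, f w <= g w) -> mean l f w <= mean l g w.
Proof. by move=> fg; apply: mean_le_off. Qed.

Lemma mean_cst l c w : mean l (fun=> c) w = c.
Proof. by elim: l w => //= i l IH w; rewrite /avg !IH; ring. Qed.

Lemma meanD l f g w : mean l (fun w => f w + g w) w = mean l f w + mean l g w.
Proof. by elim: l w => //= i l IH w; rewrite /avg !IH; ring. Qed.

Lemma meanZ l c f w : mean l (fun w => c * f w) w = c * mean l f w.
Proof. by elim: l w => //= i l IH w; rewrite /avg !IH; ring. Qed.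

Lemma meanB l f g w : mean l (fun w => f w - g w) w = mean l f w - mean l g w.
Proof. by elim: l w => //= i l IH w; rewrite /avg !IH; ring. Qed.

Lemma mean_depends A l f : depends A f -> depends A (mean l f).
Proof.
move=> fA; elim: l => //= i l IH w w' ww'; rewrite /avg.
by congr (_ * _ + _ * _); apply: IH => j Aj; rewrite /upd; case: eqP => // _; apply: ww'.
Qed.

Lemma avg_depends i f A w : depends A f -> ~~ A i -> avg i f w = f w.
Proof. by move=> fA Ai; rewrite /avg !(upd_out _ _ fA Ai); ring. Qed.

Lemma mean_out l f A w : depends A f -> {in l, forall i, ~~ A i} ->
  mean l f w = f w.
Proof.
move=> fA; elim: l w => //= i l IH w Al.
have mf : mean l f =1 f.
  by move=> w'; apply: IH => j jl; apply: Al; rewrite inE jl orbT.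
by rewrite (avg_ext _ _ mf) (avg_depends _ fA) // Al ?mem_head.
Qed.

(** Independence of functions with disjoint supports, for any list of averaged
    coordinates. *)
Lemma mean_indep A l f g w : depends A f -> depends (predC A) g ->
  mean l (fun w => f w * g w) w = mean l f w * mean l g w.
Proof.
move=> fA gA; elim: l w => //= i l IH w.
have mf := mean_depends l fA; have mg := mean_depends l gA.
rewrite (avg_ext _ _ IH); have [Ai|nAi] := boolP (A i).
  rewrite (avg_depends _ mg) /= ?Ai // /avg !(upd_out _ _ mg) /= ?Ai //; ring.
rewrite (avg_depends _ mf) //= /avg !(upd_out _ _ mf) //; ring.
Qed.

Lemma mean_coord l i (b : bool) w : uniq l -> i \in l ->
  mean l (fun w => (w i == b)%:R) w = if b then q i else 1 - q i.
Proof.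
elim: l w => //= j l IH w /andP[jl ul]; rewrite inE.
have [->|nij] := eqVneq i j.
  have d : depends (pred1 j) (fun w => (w j == b)%:R : R).
    by move=> w1 w2 H; rewrite H //=.
  move=> _; have dl : depends (predC (mem l)) (fun w => (w j == b)%:R : R).
    by apply: dependsW d => k /eqP->.
  have ml : mean l (fun w => (w j == b)%:R) =1 (fun w => (w j == b)%:R).
    by move=> w1; apply: mean_out dl _ => k kl /=; rewrite kl.
  by rewrite (avg_ext _ _ ml) /avg /upd eqxx; case: (b) => /=; ring.
by move=> /= il; rewrite /avg !IH //; ring.
Qed.

End Averaging.
(** * Exploring the columns *)

Section Columns.
Variables K L : nat.

Definition site := (nat * nat)%type.
(** The variables attached to a column: the letter at a height, the vertical
    edge from a height h with length n + 1, and the horizontal edge at a height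
    in one of two directions. *)
Definition slot := (nat + (nat * nat + bool * nat))%type.
Definition coord := (site * slot)%type.
Definition letter (c : site) h : coord := (c, inl h).
Definition rise (c : site) h n : coord := (c, inr (inl (h, n))).
Definition cross (c : site) (b : bool) h : coord := (c, inr (inr (b, h))).

Lemma letter_eq c h h' : (letter c h == letter c h') = (h == h').
Proof. by rewrite xpair_eqE eqxx. Qed.

Lemma rise_letter c h n c' h' : (rise c h n == letter c' h') = false.
Proof. by rewrite xpair_eqE andbF. Qed.

Lemma cross_letter c b h c' h' : (cross c b h == letter c' h') = false.
Proof. by rewrite xpair_eqE andbF. Qed.

Implicit Types (w : coord -> bool) (c : site) (xi : nat -> bool).

(** From height h of column c, the jump of length n + 1 reaches a vertex with
    letter a from which the horizontal edge in direction b is open.  The letter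
    at the far end of that edge belongs to the next column and is left
    unrevealed. *)
Definition hit (a b : bool) c h n w : bool :=
  [&& w (rise c h n), w (letter c (h + n.+1)) == a & w (cross c b (h + n.+1))].

Definition exits (a b : bool) c h w : seq nat :=
  [seq (h + n.+1)%N | n <- iota 0 K & hit a b c h n w].

Definition ample (a : bool) c h w : bool :=
  (L <= size (exits a true c h w))%N && (L <= size (exits a false c h w))%N.

(** Takes the lowest candidate height with letter b, and gives up if the exits
    from it are too few.  When the candidates increase, the letters inspected up
    to the choice g lie at heights at most g, while [ample] at g looks
    strictly above g. *)
Fixpoint settle (a b : bool) c (G : seq nat) w : option nat :=
  if G is g :: G' then
    if w (letter c g) == b then (if ample a c g w then Some g else None)
    else settle a b c G' w
  else None.

Definition level c : nat := c.1 + c.2.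
Definition west c : site := (c.1.-1, c.2).
Definition south c : site := (c.1, c.2.-1).

(** The candidates in column c come from a single predecessor, the western one
    when it is available; this makes them increasing without any merging. *)
Definition entries xi c (fw fs : option nat) w : seq nat :=
  let a := xi (level c).-1.*2 in
  match fw, fs with
  | Some h, _ => exits a true (west c) h w
  | None, Some h => exits a false (south c) h w
  | None, None => [::]
  end.

(** Some h when the exploration for the word xi occupies height h of column c.
    A site at level m is reached after 2 m letters: its arrival letter is
    [xi m.*2.-1] and the jump leaving it needs [xi m.*2]. *)
Fixpoint settled_rec xi (m : nat) c w : option nat :=
  if m is m'.+1 then
    settle (xi m.*2) (xi m.*2.-1) c
      (entries xi c (if (0 < c.1)%N then settled_rec xi m' (west c) w else None)
                    (if (0 < c.2)%N then settled_rec xi m' (south c) w else None) w) w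
  else if ample (xi 0) c 0 w then Some 0 else None.

Definition settled xi c := settled_rec xi (level c) c.
Definition from_west xi c w : option nat :=
  if (0 < c.1)%N then settled xi (west c) w else None.
Definition from_south xi c w : option nat :=
  if (0 < c.2)%N then settled xi (south c) w else None.

Lemma settledE xi c w : (0 < level c)%N -> settled xi c w =
  settle (xi (level c).*2) (xi (level c).*2.-1) c
    (entries xi c (from_west xi c w) (from_south xi c w) w) w.
Proof.
case: c => i j; rewrite /settled /from_west /from_south /level /west /south /=.
rewrite /settled /level /=; case E : (i + j)%N => [//|m] _ /=.
congr settle; congr entries; case: ltnP => //= H.
  by have -> : (i.-1 + j = m)%N by lia.
by have -> : (i + j.-1 = m)%N by lia.
Qed.

Definition failed xi c w : bool :=
  [|| c == (0, 0)%N, from_west xi c w | from_south xi c w] && ~~ settled xi c w.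

Lemma mem_exits a b c h w x : reflect
  (exists n, [/\ (n < K)%N, hit a b c h n w & x = (h + n.+1)%N])
  (x \in exits a b c h w).
Proof.
apply: (iffP mapP) => [[n]|[n [nK hn ->]]].
  by rewrite mem_filter mem_iota => /andP[? /andP[_ ?]] ->; exists n.
by exists n; rewrite // mem_filter hn mem_iota.
Qed.

Lemma exits_sorted a b c h w : sorted ltn (exits a b c h w).
Proof.
rewrite sorted_map; apply: sorted_filter.
  by move=> x y z /=; apply: ltn_trans.
rewrite (@eq_sorted _ _ ltn); first exact: iota_ltn_sorted.
by move=> x y /=; rewrite ltn_add2l ltnS.
Qed.

Lemma settle_some a b c G w h : settle a b c G w = Some h ->
  [/\ h \in G, w (letter c h) = b & ample a c h w].
Proof.
elim: G => //= g G IH; case: eqP => [wb|_ /IH[hG ? ?]]; last first.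
  by split => //; rewrite inE hG orbT.
by case: ifP => // ag [<-]; rewrite mem_head.
Qed.

Lemma settled_some xi c w h : settled xi c w = Some h ->
  ample (xi (level c).*2) c h w /\ (h <= level c * K)%N.
Proof.
move: {2}(level c) (erefl (level c)) => m; elim: m c h => [|m IH] c h cm.
  by rewrite /settled cm /=; case: ifP => // ? [<-].
rewrite settledE ?cm // => /settle_some[hG _ ah]; split=> //.
move: hG; rewrite /entries; case: c cm ah => i j; rewrite /level /= => cm _.
case fw: from_west => [h'|].
  move: fw; rewrite /from_west /=; case: ltnP => // i0 /IH[|_ h'm].
    by rewrite /level /=; lia.
  move=> /mem_exits[n [nK _ ->]]; move: h'm; rewrite /level /=.
  by (have -> : (i.-1 + j = m)%N by lia); rewrite mulSn; lia.
case fs: from_south => [h'|//].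
move: fs; rewrite /from_south /=; case: ltnP => // i0 /IH[|_ h'm].
  by rewrite /level /=; lia.
move=> /mem_exits[n [nK _ ->]]; move: h'm; rewrite /level /=.
by (have -> : (i + j.-1 = m)%N by lia); rewrite mulSn; lia.
Qed.

Definition slots (H : nat) : seq slot :=
  [seq inl h | h <- iota 0 H] ++
  [seq inr x | x <-
    [seq inl (h, n) | h <- iota 0 H, n <- iota 0 K] ++
    [seq inr (b, h) | b <- [:: true; false], h <- iota 0 H]].

(** Coordinates of a column whose heights are below H; there are finitely many,
    as edges longer than K are left out. *)
Definition low (H : nat) (k : slot) : bool :=
  match k with
  | inl h => (h < H)%N
  | inr (inl (h, n)) => (h < H)%N && (n < K)%N
  | inr (inr (_, h)) => (h < H)%N
  end.

Lemma mem_slots H k : (k \in slots H) = low H k.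
Proof.
apply/idP/idP.
  rewrite mem_cat => /orP[/mapP[h + ->]|/mapP[x + ->]]; first by rewrite mem_iota.
  rewrite mem_cat => /orP[] /allpairsP[[y z] /= []]; rewrite !mem_iota /=.
    by move=> ? ? -> /=; apply/andP.
  by move=> _ ? -> /=.
rewrite mem_cat; case: k => [h|[[h n]|[b h]]] H1; apply/orP; [left|right|right].
- by apply/mapP; exists h; rewrite ?mem_iota.
- apply/mapP; exists (inl (h, n)) => //; rewrite mem_cat; apply/orP; left.
  by case/andP: H1 => ? ?; apply/allpairsP; exists (h, n); rewrite /= !mem_iota.
- apply/mapP; exists (inr (b, h)) => //; rewrite mem_cat; apply/orP; right.
  by apply/allpairsP; exists (b, h); rewrite /= !mem_iota; split=> //; case: (b).
Qed.

Lemma slots_uniq H : uniq (slots H).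
Proof.
have inlI (T U : eqType) : injective (@inl T U) by move=> x y [].
have inrI (T U : eqType) : injective (@inr T U) by move=> x y [].
rewrite cat_uniq; apply/and3P; split; first by rewrite map_inj_uniq ?iota_uniq //; apply: inlI.
  by apply/hasPn => x /mapP[y _ ->]; apply/mapP => -[].
rewrite map_inj_uniq; last exact: inrI.
rewrite cat_uniq; apply/and3P; split.
- by apply: allpairs_uniq; rewrite ?iota_uniq // => -[x y] [z t] _ _ /= [-> ->].
- apply/hasPn => x /allpairsP[[b h] [_ _ ->]] /=.
  by apply/negP => /allpairsP[[h' n] [_ _]].
- by apply: allpairs_uniq; rewrite ?iota_uniq // => -[x y] [z t] _ _ /= [-> ->].
Qed.

Definition column (H : nat) c : seq coord := [seq (c, k) | k <- slots H].

Lemma mem_column H c i : (i \in column H c) = (i.1 == c) && low H i.2.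
Proof.
case: i => c' k /=; rewrite -mem_slots; apply/mapP/andP.
  by move=> [k' kk [-> ->]].
by move=> [/eqP -> kH]; exists k.
Qed.

Lemma column_uniq H c : uniq (column H c).
Proof. by rewrite map_inj_uniq ?slots_uniq // => x y []. Qed.

Definition window H c : pred coord := fun i => (i.1 == c) && low H i.2.

Lemma hit_depends a b c h n H : (h + K < H)%N -> (n < K)%N ->
  depends (window H c) (hit a b c h n).
Proof.
move=> hH nK w w' ww; rewrite /hit !ww //; rewrite /window /= eqxx //=; lia.
Qed.

Lemma exits_depends a b c h H : (h + K < H)%N ->
  depends (window H c) (exits a b c h).
Proof.
move=> hH w w' ww; rewrite /exits; congr map; apply: eq_in_filter => n.
by rewrite mem_iota add0n => nK; apply: hit_depends ww.
Qed.

Lemma ample_depends a c h H : (h + K < H)%N ->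
  depends (window H c) (ample a c h).
Proof. by move=> hH w w' ww; rewrite /ample !(exits_depends _ _ hH ww). Qed.

Lemma settle_depends a b c G H : {in G, forall g, (g + K < H)%N} ->
  depends (window H c) (settle a b c G).
Proof.
elim: G => //= g G IH GH w w' ww.
have gH := GH _ (mem_head _ _).
rewrite (ample_depends _ gH ww) (IH _ _ _ ww).
  by rewrite ww // /window /= eqxx /=; lia.
by move=> x xG; apply: GH; rewrite inE xG orbT.
Qed.

Definition below H c : pred coord :=
  fun i => [&& (i.1.1 <= c.1)%N, (i.1.2 <= c.2)%N & low H i.2].

Lemma entries_low xi c w g : (0 < level c)%N ->
  g \in entries xi c (from_west xi c w) (from_south xi c w) w ->
  (g <= level c * K)%N.
Proof.
move=> c0; rewrite /entries.
have lw : (0 < c.1)%N -> level c = (level (west c)).+1.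
  by rewrite /level /=; lia.
have ls : (0 < c.2)%N -> level c = (level (south c)).+1.
  by rewrite /level /=; lia.
case fw: from_west => [h|].
  move: fw; rewrite /from_west; case: ltnP => // /lw -> /settled_some[_ hl].
  by move=> /mem_exits[n [nK _ ->]]; rewrite mulSn; lia.
case fs: from_south => [h|//].
move: fs; rewrite /from_south; case: ltnP => // /ls -> /settled_some[_ hl].
by move=> /mem_exits[n [nK _ ->]]; rewrite mulSn; lia.
Qed.

(** Oriented steps only lead north or east, so the fate of a site is decided by
    the columns to its south-west; heights grow by at most K per level. *)
Lemma settled_depends xi c H : ((level c).+1 * K < H)%N ->
  depends (below H c) (settled xi c).
Proof.
move: {2}(level c) (erefl (level c)) => m; elim: m c => [|m IH] c cm cH w w' ww.
  rewrite /settled cm /= (@ample_depends _ c 0 H _ w w') //.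
    by move: cH; rewrite cm; lia.
  by move=> i /andP[/eqP ic iH]; apply: ww; rewrite /below ic !leqnn.
have W : (0 < c.1)%N -> level (west c) = m.
  by move: cm; rewrite /level /=; lia.
have S : (0 < c.2)%N -> level (south c) = m.
  by move: cm; rewrite /level /=; lia.
have mH : (m.+1 * K < H)%N by move: cH; rewrite cm mulSn; lia.
have bw : {subset below H (west c) <= below H c}.
  move=> i /and3P[/= h1 h2 h3]; apply/and3P; split=> //.
  by apply: leq_trans h1 _; apply: leq_pred.
have bs : {subset below H (south c) <= below H c}.
  move=> i /and3P[/= h1 h2 h3]; apply/and3P; split=> //.
  by apply: leq_trans h2 _; apply: leq_pred.
have wE c' h : {subset below H c' <= below H c} -> (h + K < H)%N ->
    forall a b, exits a b c' h w = exits a b c' h w'.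
  move=> sub hH a b; apply: (exits_depends a b hH) => i /andP[/eqP ic iH].
  by apply: ww; apply: sub; rewrite unfold_in /below ic !leqnn.
have fwE : from_west xi c w = from_west xi c w'.
  rewrite /from_west; case: ltnP => // /W Wm.
  by apply: (IH _ Wm); rewrite ?Wm // => i ib; apply: ww; apply: bw.
have fsE : from_south xi c w = from_south xi c w'.
  rewrite /from_south; case: ltnP => // /S Sm.
  by apply: (IH _ Sm); rewrite ?Sm // => i ib; apply: ww; apply: bs.
rewrite !settledE ?cm // -fwE -fsE.
have eE : entries xi c (from_west xi c w) (from_south xi c w) w =
          entries xi c (from_west xi c w) (from_south xi c w) w'.
  rewrite /entries; case fw: from_west => [h|].
    apply: wE => //; move: fw; rewrite /from_west; case: ltnP => // /W Wm.
    by move=> /settled_some[_]; rewrite Wm; move: mH; rewrite mulSn; lia.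
  case fs: from_south => [h|//].
  apply: wE => //; move: fs; rewrite /from_south; case: ltnP => // /S Sm.
  by move=> /settled_some[_]; rewrite Sm; move: mH; rewrite mulSn; lia.
rewrite -eE; apply: (@settle_depends _ _ _ _ H).
  move=> g /entries_low; rewrite cm => /(_ isT).
  by move: cH; rewrite cm mulSn; lia.
by move=> i /andP[/eqP ic iH]; apply: ww; rewrite /below ic !leqnn.
Qed.

Lemma from_west_depends xi c H : ((level c).+1 * K < H)%N ->
  depends (fun i => below H c i && (i.1 != c)) (from_west xi c).
Proof.
move=> cH w w' ww; rewrite /from_west; case: ltnP => // c1.
apply: (@settled_depends xi _ H).
  by apply: leq_ltn_trans cH; rewrite leq_mul2r ltnS /level /= leq_add2r leq_pred orbT.
move=> i /and3P[/= h1 h2 h3]; apply: ww; apply/andP; split.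
  by apply/and3P; split => //; apply: leq_trans h1 (leq_pred _).
by apply/eqP => ic; move: h1; rewrite ic; case: c.1 c1 => // n _; rewrite ltnn.
Qed.

Lemma from_south_depends xi c H : ((level c).+1 * K < H)%N ->
  depends (fun i => below H c i && (i.1 != c)) (from_south xi c).
Proof.
move=> cH w w' ww; rewrite /from_south; case: ltnP => // c2.
apply: (@settled_depends xi _ H).
  by apply: leq_ltn_trans cH; rewrite leq_mul2r ltnS /level /= leq_add2l leq_pred orbT.
move=> i /and3P[/= h1 h2 h3]; apply: ww; apply/andP; split.
  by apply/and3P; split => //; apply: leq_trans h2 (leq_pred _).
by apply/eqP => ic; move: h2; rewrite ic; case: c.2 c2 => // n _; rewrite ltnn.
Qed.

Lemma failed_depends xi c H : ((level c).+1 * K < H)%N ->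
  depends (below H c) (failed xi c).
Proof.
move=> cH w w' ww; rewrite /failed (settled_depends xi cH ww).
have sub i : below H c i && (i.1 != c) -> w i = w' i by move=> /andP[/ww].
by rewrite (from_west_depends xi cH sub) (from_south_depends xi cH sub).
Qed.

Lemma entries_ample xi c w : (0 < level c)%N ->
  from_west xi c w || from_south xi c w ->
  (L <= size (entries xi c (from_west xi c w) (from_south xi c w) w))%N.
Proof.
move=> c0; rewrite /entries.
case fw: from_west => [h|] /=.
  move: fw; rewrite /from_west; case: ltnP => // c1 /settled_some[+ _] _.
  have -> : level (west c) = (level c).-1 by rewrite /level /=; lia.
  by case/andP.
case fs: from_south => [h|] //= _.
move: fs; rewrite /from_south; case: ltnP => // c1 /settled_some[+ _].
have -> : level (south c) = (level c).-1 by rewrite /level /=; lia.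
by case/andP.
Qed.

Lemma entries_sorted xi c fw fs w : sorted ltn (entries xi c fw fs w).
Proof. by rewrite /entries; case: fw fs => [?|] [?|] //; apply: exits_sorted. Qed.

Definition columns (H : nat) (cs : seq site) : seq coord :=
  flatten [seq column H c | c <- cs].

Lemma columns_uniq H cs : uniq cs -> uniq (columns H cs).
Proof.
elim: cs => //= c cs IH /andP[ccs ucs].
rewrite /columns /= cat_uniq column_uniq IH // andbT.
apply/hasPn => i /flatten_mapP[c' c's]; rewrite mem_column => /andP[/eqP ic' _].
by rewrite mem_column ic' negb_and; apply/orP; left; apply: contraNneq ccs => <-.
Qed.

Lemma mem_columns H cs i : (i \in columns H cs) = (i.1 \in cs) && low H i.2.
Proof.
apply/flatten_mapP/andP => [[c cs_c]|[ics il]].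
  by rewrite mem_column => /andP[/eqP -> ->].
by exists i.1 => //; rewrite mem_column eqxx.
Qed.

End Columns.

(** * Probability that a site fails *)

Section ColumnFailure.
Variables (R : realFieldType) (K L : nat) (p eps : R) (pn : nat -> R).
Hypotheses (p01 : 0 < p < 1) (eps01 : 0 < eps <= 1)
  (pn01 : forall n, (1 <= n)%N -> 0 <= pn n <= 1).
Implicit Types (w : coord -> bool) (c : site) (xi : nat -> bool).

Definition weight (i : coord) : R :=
  match i.2 with
  | inl _ => p
  | inr (inl (_, n)) => if (n < K)%N then pn n.+1 else 0
  | inr (inr _) => eps
  end.

Lemma weight01 i : 0 <= weight i <= 1.
Proof.
case: i => [c [h|[[h n]|[b h]]]]; rewrite /weight /=; last 1 first.
- by have := eps01; lra.
- by have := p01; lra.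
- by case: ifP => _; [exact: pn01 | rewrite lexx ler01].
Qed.

Notation exits := (exits K).
Notation ample := (ample K L).
Notation settle := (settle K L).
Notation settled := (settled K L).
Notation failed := (failed K L).
Notation from_west := (from_west K L).
Notation from_south := (from_south K L).
Notation entries := (entries K).
Notation column := (column K).
Notation columns := (columns K).
Notation below := (below K).

Definition rarer : R := Num.min p (1 - p).
Definition likelier : R := Num.max p (1 - p).
(** Bounds the mean of 2 ^ - N, where N counts the hits from a vertex in one
    direction: each hit has probability at least
    [rarer * eps * pn n.+1]. *)
Definition scarcity : R := \prod_(n < K) (1 - rarer * eps * pn n.+1 / 2).
Definition delta : R := likelier ^+ L + 2 * 2 ^+ L * scarcity.

Notation mean := (mean weight).
Notation ind := (@ind R coord).

Definition letter_prob (a : bool) : R := if a then p else 1 - p.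

Lemma rarer_le a : rarer <= letter_prob a.
Proof. by rewrite /rarer /letter_prob ge_min; case: a; rewrite lexx ?orbT. Qed.

Lemma rarer01 : 0 < rarer < 1.
Proof.
have := p01; rewrite /rarer lt_min gt_min => /andP[-> p1].
by rewrite p1 subr_gt0 p1.
Qed.

Lemma likelier01 : 0 < likelier < 1.
Proof.
have := p01; rewrite /likelier lt_max gt_max => /andP[p0 p1].
by rewrite p0 p1 /=; lra.
Qed.

Lemma scarcity_ge0 : 0 <= scarcity.
Proof.
apply: prodr_ge0 => n _.
have /andP[q0 q1] := pn01 (ltn0Sn n); have /andP[e0 e1] := eps01.
have /andP[r0 r1] := rarer01.
have : rarer * eps * pn n.+1 <= 1 by rewrite !mulr_ile1 // ?mulr_ge0 //; lra.
by lra.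
Qed.

Lemma letter_prob_le a : letter_prob a <= likelier.
Proof. by rewrite /likelier /letter_prob le_max; case: a; rewrite lexx ?orbT. Qed.

Lemma mean_hit l a b c h n w : uniq l -> (n < K)%N ->
  rise c h n \in l -> letter c (h + n.+1) \in l -> cross c b (h + n.+1) \in l ->
  mean l (ind (hit a b c h n)) w = pn n.+1 * letter_prob a * eps.
Proof.
move=> ul nK l1 l2 l3.
have coordD (i : coord) (x : bool) : depends (pred1 i) (fun w => (w i == x)%:R : R).
  by move=> w1 w2 H; rewrite H //=.
have coordN (i j : coord) (x : bool) : i != j ->
    depends (predC (pred1 j)) (fun w => (w i == x)%:R : R).
  by move=> ij; apply: dependsW (coordD i x) => k /eqP->.
rewrite (@mean_ext _ _ _ _ _ (fun w => (w (rise c h n) == true)%:R *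
   ((w (letter c (h + n.+1)) == a)%:R * (w (cross c b (h + n.+1)) == true)%:R))); last first.
  by move=> w1; rewrite /ind /hit !eqb_id -!natrM !mulnb.
rewrite (mean_indep _ _ _ (coordD _ _)); last first.
  by move=> w1 w2 H; rewrite !H //= xpair_eqE andbF.
rewrite (mean_indep _ _ _ (coordD _ _)); last first.
  by apply: coordN; rewrite xpair_eqE andbF.
by rewrite !mean_coord // /weight /= nK mulrA.
Qed.

Lemma half_power_hits a b c h k w :
  \prod_(n < k) (1 - ind (hit a b c h n) w / 2) =
  2^-1 ^+ count (fun n => hit a b c h n w) (iota 0 k).
Proof.
elim: k => [|k IH]; first by rewrite big_ord0.
have iotaE : iota 0 k.+1 = iota 0 k ++ [:: k] by rewrite -addn1 iotaD.
rewrite big_ord_recr IH iotaE count_cat exprD /= /ind.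
by congr (_ * _); case: hit; rewrite /= ?expr0 ?expr1; field.
Qed.

(** The hits for different lengths use disjoint sets of coordinates. *)
Lemma mean_half_power l a b c h k w H : uniq l -> {subset column H c <= l} ->
  (h + K < H)%N -> (k <= K)%N ->
  mean l (fun w => \prod_(n < k) (1 - ind (hit a b c h n) w / 2)) w =
  \prod_(n < k) (1 - pn n.+1 * letter_prob a * eps / 2).
Proof.
move=> ul sl hH; elim: k w => [|k IH] w kK.
  rewrite big_ord0 -[RHS](mean_cst weight l 1 w).
  by apply: mean_ext => w'; rewrite big_ord0.
(* The coordinates used by the jumps of index less than k; the k-th jump uses
   none of them. *)
pose A : pred coord := fun i => match i.2 with
  | inl h' => (h' < h + k.+1)%N
  | inr (inl (_, n)) => (n < k)%N
  | inr (inr (_, h')) => (h' < h + k.+1)%N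
  end.
under mean_ext do rewrite big_ord_recr /=.
rewrite (@mean_indep _ _ _ A).
- rewrite big_ord_recr /= IH; last exact: ltnW.
  congr (_ * _).
  rewrite meanB mean_cst; congr (_ - _).
  under mean_ext do rewrite mulrC.
  rewrite meanZ mean_hit // 1?mulrC //; apply: sl; rewrite mem_column /= eqxx /=; lia.
- move=> w1 w2 ww; apply: eq_bigr => n _; congr (1 - _ / 2).
  by rewrite /ind /hit !ww // /A /=; have := ltn_ord n; lia.
- move=> w1 w2 ww; congr (1 - _ / 2).
  by rewrite /ind /hit !ww // /A /= ltnn.
Qed.

Lemma scarcity_bound a : \prod_(n < K) (1 - pn n.+1 * letter_prob a * eps / 2) <= scarcity.
Proof.
apply: ler_prod => n _; have /andP[q0 q1] := pn01 (ltn0Sn n).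
have := rarer_le a; have := letter_prob_le a; have /andP[r0 r1] := rarer01.
have /andP[l0 l1] := likelier01; have /andP[e0 e1] := eps01.
move: (letter_prob a) => x xl rx.
apply/andP; split.
  rewrite subr_ge0 ler_pdivrMr // mul1r.
  have : pn n.+1 * x * eps <= 1.
    by rewrite !mulr_ile1 // ?mulr_ge0 //; lra.
  lra.
have xr : rarer * (eps * pn n.+1) <= x * (eps * pn n.+1).
  by rewrite ler_wpM2r // mulr_ge0 // ltW.
rewrite lerD2l lerN2 ler_pM2r ?invr_gt0 // -mulrA.
by have -> : pn n.+1 * x * eps = x * (eps * pn n.+1) by ring.
Qed.

(** Markov's inequality for 2 ^ - N, in each of the two directions. *)
Lemma mean_not_ample l a c h w H : uniq l -> {subset column H c <= l} ->
  (h + K < H)%N ->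
  mean l (ind (fun w => ~~ ample a c h w)) w <= 2 * 2 ^+ L * scarcity.
Proof.
move=> ul sl hH.
have few b : mean l (ind (fun w => (size (exits a b c h w) < L)%N)) w <= 2 ^+ L * scarcity.
  apply: le_trans (_ : 2 ^+ L * mean l (fun w =>
    \prod_(n < K) (1 - ind (hit a b c h n) w / 2)) w <= _).
    rewrite -meanZ; apply: mean_le; first exact: weight01.
    move=> w1; rewrite half_power_hits /ind size_map size_filter.
    set m := count _ _; case: ltnP => [mL|_]; last first.
      by rewrite mulr_ge0 // exprn_ge0 // invr_ge0.
    rewrite exprVn ler_pdivlMr ?exprn_gt0 // mul1r.
    by apply: ler_weXn2l; [rewrite ler1n | exact: ltnW].
  rewrite ler_pM2l ?exprn_gt0 // (mean_half_power _ _ _ ul sl hH) //.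
  exact: scarcity_bound.
apply: le_trans (_ : 2 ^+ L * scarcity + 2 ^+ L * scarcity <= _); last by lra.
apply: le_trans (lerD (few true) (few false)); rewrite -meanD.
apply: mean_le; first exact: weight01.
move=> w1; rewrite /ind -natrD ler_nat /ample negb_and -!ltnNge.
by case: (_ < L)%N; case: (_ < L)%N.
Qed.

(** By induction on the candidates: the letter at the first one, g, is
    independent of the exits from g and of everything that happens at the higher
    candidates.  Either it is correct and the exits from g must be too few,
    or it is wrong and the remaining candidates are tried. *)
Lemma mean_settle_none l a b c G w H : uniq l -> {subset column H c <= l} ->
  {in G, forall g, (g + K < H)%N} -> sorted ltn G ->
  mean l (ind (fun w => ~~ settle a b c G w)) w <=
  likelier ^+ size G + 2 * 2 ^+ L * scarcity.
Proof.
move=> ul sl; set D := _ * scarcity.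
have D0 : 0 <= D.
  by rewrite /D !mulr_ge0 ?scarcity_ge0 ?exprn_ge0.
elim: G w => [|g G IH] w GH srt.
  by rewrite /= /ind mean_cst expr0 lerDl.
have gH := GH _ (mem_head _ _).
have GH' : {in G, forall g, (g + K < H)%N}.
  by move=> x xG; apply: GH; rewrite inE xG orbT.
have coordD x : depends (pred1 (letter c g)) (fun w => (w (letter c g) == x)%:R : R).
  by move=> w1 w2 E; rewrite E //=.
have gl : letter c g \in l by apply: sl; rewrite mem_column /= eqxx /=; lia.
have aD : depends (predC (pred1 (letter c g))) (ind (fun w => ~~ ample a c g w)).
  apply: depends_ind => w1 w2 ww; congr (~~ _).
  have e d : exits a d c g w1 = exits a d c g w2.
    rewrite /exits; congr map; apply: eq_filter => n.
    by rewrite /hit !ww /= ?rise_letter ?cross_letter ?letter_eq //; lia.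
  by rewrite /ample !e.
have sD : depends (predC (pred1 (letter c g))) (ind (fun w => ~~ settle a b c G w)).
  apply: depends_ind => w1 w2 ww; congr (~~ isSome _).
  have {}srt : all (ltn g) G by apply: order_path_min srt => x y z /=; apply: ltn_trans.
  elim: G srt {IH GH GH'} => //= x G IH /andP[gx aG]; rewrite IH //.
  have e d : exits a d c x w1 = exits a d c x w2.
    rewrite /exits; congr map; apply: eq_filter => n.
    by rewrite /hit !ww /= ?rise_letter ?cross_letter ?letter_eq //; lia.
  by rewrite /ample !e ww //= letter_eq; lia.
rewrite (@mean_ext _ _ _ _ _ (fun w =>
  (w (letter c g) == b)%:R * ind (fun w => ~~ ample a c g w) w +
  (w (letter c g) == ~~ b)%:R * ind (fun w => ~~ settle a b c G w) w)); last first.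
  move=> w1; rewrite /ind /=; case: (w1 (letter c g)); case: (b) => /=;
    rewrite ?mul0r ?mul1r ?addr0 ?add0r //; by case: ample.
rewrite meanD (mean_indep _ _ _ (coordD _) aD) (mean_indep _ _ _ (coordD _) sD).
rewrite !mean_coord //.
have -> : (if b then weight (letter c g) else 1 - weight (letter c g)) = letter_prob b by [].
have -> : (if ~~ b then weight (letter c g) else 1 - weight (letter c g)) = letter_prob (~~ b).
  by [].
have h1 := mean_not_ample a w ul sl gH; rewrite -/D in h1.
have h2 := IH w GH' (path_sorted srt).
have b1 : letter_prob b = 1 - letter_prob (~~ b) by rewrite /letter_prob; case: (b) => /=; lra.
have lb := letter_prob_le (~~ b).
have lb0 : 0 <= letter_prob (~~ b).
  by apply: le_trans (rarer_le _); case/andP: rarer01 => /ltW.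
have lb1 : letter_prob (~~ b) <= 1 by case/andP: likelier01 => _ /ltW; apply: le_trans.
have bp : 0 <= letter_prob b by rewrite b1; lra.
apply: le_trans (lerD (ler_wpM2l bp h1) (ler_wpM2l lb0 h2)) _.
rewrite b1 mulrDr exprS /=.
have : letter_prob (~~ b) * likelier ^+ size G <= likelier * likelier ^+ size G.
  by rewrite ler_wpM2r // exprn_ge0 // ltW //; case/andP: likelier01.
by lra.
Qed.
Lemma delta_ge0 : 0 <= delta.
Proof.
rewrite /delta addr_ge0 ?mulr_ge0 ?scarcity_ge0 ?exprn_ge0 //.
by case/andP: likelier01 => /ltW.
Qed.

(** Freezing all other columns fixes the candidates of column c, so that the
    bound for a deterministic list of candidates applies; F accounts for what
    happens in the other columns. *)
Lemma mean_failed xi c w (F : (coord -> bool) -> R) H :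
  ((level c).+1 * K < H)%N -> (forall w, 0 <= F w) ->
  depends (fun i => i.1 != c) F ->
  mean (column H c) (fun w => F w * ind (failed xi c) w) w <= F w * delta.
Proof.
move=> cH F0 FD.
have off w' : (forall i, i \notin column H c -> w' i = w i) ->
    forall i, i.1 != c -> w' i = w i.
  by move=> E i ic; apply: E; rewrite mem_column (negbTE ic).
have Kl : (level c * K + K < H)%N by move: cH; rewrite mulSn addnC.
have sub : {subset column H c <= column H c} by [].
pose bound g := mean (column H c) (ind (fun w' => ~~ g w')) w <= delta.
suff main g : bound g ->
    (forall w', (forall i, i \notin column H c -> w' i = w i) ->
       failed xi c w' -> ~~ g w') ->
    mean (column H c) (fun w => F w * ind (failed xi c) w) w <= F w * delta.
  have [c0|c0] := posnP (level c).
    have c00 : c = (0, 0)%N by move: c0; case: (c) => [[|?] [|?]].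
    apply: (main (ample (xi 0%N) c 0)).
      have KH : (0 + K < H)%N by move: cH; rewrite c0 mul1n.
      rewrite /bound; apply: le_trans (mean_not_ample _ _ (column_uniq K H c) sub KH) _.
      by have /andP[l0 _] := likelier01; rewrite /delta lerDr exprn_ge0 // ltW.
    move=> w' _ /andP[_]; rewrite /settled c0 /= c00.
    by case: ample.
  pose G := entries xi c (from_west xi c w) (from_south xi c w) w.
  have [src|nsrc] := boolP (from_west xi c w || from_south xi c w); last first.
    apply: (main (fun=> true)).
      by rewrite /bound /ind mean_cst delta_ge0.
    move=> w' /off E /andP[+ _].
    have agree i : below H c i && (i.1 != c) -> w' i = w i by move=> /andP[_ /E].
    rewrite (from_west_depends L xi cH agree) (from_south_depends L xi cH agree) (negbTE nsrc) orbF.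
    by move=> /eqP c00; rewrite c00 in c0.
  apply: (main (settle (xi (level c).*2) (xi (level c).*2.-1) c G)).
    rewrite /bound.
    apply: le_trans (mean_settle_none _ _ w (column_uniq K H c) sub _
      (entries_sorted _ _ _ _ _ _)) _.
      by move=> g /entries_low => /(_ c0); lia.
    rewrite /delta lerD2r; have /andP[l0 l1] := likelier01.
    by rewrite ler_wiXn2l ?(ltW l0) ?(ltW l1) // entries_ample.
  move=> w' /off E /andP[_]; rewrite settledE //.
  have agree i : below H c i && (i.1 != c) -> w' i = w i by move=> /andP[_ /E].
  rewrite (from_west_depends L xi cH agree) (from_south_depends L xi cH agree).
  suff -> : entries xi c (from_west xi c w) (from_south xi c w) w' = G by [].
  rewrite /G /entries.
  have ex c' a b h : c' != c -> exits a b c' h w' = exits a b c' h w.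
    move=> c'c; apply: (@exits_depends K a b c' h (h + K).+1) => // i /andP[/eqP ic _].
    by apply: E; rewrite ic.
  case fw: from_west => [h|].
    apply: ex; apply/eqP => wc; move: fw; rewrite /from_west; case: ltnP => //.
    by move: (congr1 fst wc) => /=; lia.
  case fs: from_south => [h|//].
  apply: ex; apply/eqP => wc; move: fs; rewrite /from_south; case: ltnP => //.
  by move: (congr1 snd wc) => /=; lia.
move=> gb gf.
apply: le_trans (_ : mean (column H c) (fun w' => F w * ind (fun w' => ~~ g w') w') w <= _).
  apply: mean_le_off; first exact: weight01.
  move=> w' E; rewrite (FD _ _ (off _ E)) ler_wpM2l // /ind ler_nat.
  by case: (boolP (failed xi c w')) => // /(gf _ E) ->.
by rewrite meanZ ler_wpM2l.
Qed.

(** The columns are averaged out starting from the highest level: the failures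
    at the remaining sites do not look at the column just averaged. *)
Lemma mean_all_failed xi cs w H :
  uniq cs -> sorted (relpre level leq) cs ->
  {in cs, forall c, ((level c).+1 * K < H)%N} ->
  mean (columns H cs) (ind (fun w => all (fun c => failed xi c w) cs)) w
    <= delta ^+ size cs.
Proof.
elim/last_ind: cs w => [|cs c IH] w; first by rewrite /= /ind /= expr0.
rewrite rcons_uniq size_rcons exprSr => /andP[ncs ucs] srt csH.
have csH' : {in cs, forall c, ((level c).+1 * K < H)%N}.
  by move=> x xcs; apply: csH; rewrite mem_rcons inE xcs orbT.
have cH : ((level c).+1 * K < H)%N by apply: csH; rewrite mem_rcons mem_head.
have lastc x : x \in cs -> (level x <= level c)%N.
  move: srt; rewrite -cats1 sorted_pairwise; last first.
    by move=> y x0 z /=; apply: leq_trans.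
  by rewrite pairwise_cat allrel1r => /and3P[/allP + _ _]; apply.
have srt' : sorted (relpre level leq) cs.
  by move: srt; rewrite -cats1 => /cat_sorted2[].
rewrite /columns map_rcons -cats1 flatten_cat mean_cat /= cats0.
apply: le_trans (_ : mean (columns H cs) (fun w =>
  delta * ind (fun w => all (fun c => failed xi c w) cs) w) w <= _).
  apply: mean_le; first exact: weight01.
  move=> w1; rewrite mulrC -/(column H c).
  rewrite (@mean_ext _ _ _ _ _ (fun w =>
    ind (fun w => all (fun c => failed xi c w) cs) w * ind (failed xi c) w)); last first.
    by move=> w2; rewrite /ind all_rcons andbC -natrM mulnb.
  apply: mean_failed => //.
  apply: depends_ind => w2 w3 ww; apply: eq_in_all => x xcs.
  apply: (failed_depends L xi (csH' _ xcs)) => i /and3P[i1 i2 _]; apply: ww.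
  apply: contraNneq ncs => ic; have := lastc _ xcs; rewrite /level -ic => lx.
  suff -> : i.1 = x by [].
  by case: (i.1) (x) i1 i2 lx => [a b] [a' b'] /= *; congr (_, _); lia.
by rewrite meanZ mulrC ler_wpM2r ?delta_ge0 // IH.
Qed.

End ColumnFailure.

(** * From averages to probabilities *)

Section Transfer.
Variables (disp : measure_display) (T : measurableType disp) (R : realType)
  (P : probability T R) (I : choiceType) (Z : I -> {RV P >-> bool}) (q : I -> R).
Hypothesis indZ : mutually_independent Z.
Hypothesis PZ : forall i, P (Z i @^-1` [set true]) = (q i)%:E.

Definition bias i (b : bool) : R := if b then q i else 1 - q i.

Lemma measurable_value i b : measurable (Z i @^-1` [set b]).
Proof. by rewrite -[X in measurable X]setTI; exact: measurable_funP. Qed.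

Lemma prob_value i b : P (Z i @^-1` [set b]) = (bias i b)%:E.
Proof.
case: b => /=; first exact: PZ.
have -> : Z i @^-1` [set false] = ~` (Z i @^-1` [set true]).
  by apply/seteqP; split=> t /=; case: (Z i t).
by rewrite probability_setC ?PZ //; apply: measurable_value.
Qed.

Definition pinned (J : seq I) (b : I -> bool) (E : (I -> bool) -> bool) : set T :=
  [set t | (forall j, j \in J -> Z j t = b j) /\ E (fun i => Z i t)].

(** Each coordinate of l is averaged out by splitting the event according to its
    value, which adds it to the cylinder; once l is exhausted, E is decided
    and mutual independence gives the probability of the cylinder. *)
Lemma pinned_prob l J b E : uniq (l ++ J) -> depends (mem (l ++ J)) E ->
  measurable (pinned J b E) /\
  P (pinned J b E) = ((\prod_(j <- J) bias j (b j)) * mean q l (ind R E) b)%:E.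
Proof.
elim: l J b => [|i l IH] J b uJ dE.
  pose J' := [fset x in J]%fset.
  have cylE : pinned J b (fun=> true) = \bigcap_(i in [set` J']) (Z i @^-1` [set b i]).
    apply/seteqP; split=> t /=.
      by move=> [tJ _] j /=; rewrite inE => /tJ.
    by move=> tJ; split=> // j jJ; apply: tJ; rewrite /= inE.
  have [Eb|nEb] := boolP (E b).
    have -> : pinned J b E = pinned J b (fun=> true).
      apply/seteqP; split=> t [tJ Et]; split=> //.
      by rewrite (dE _ b).
    rewrite cylE; split.
      by apply: fin_bigcap_measurable => // j _; apply: measurable_value.
    rewrite indZ; last by move=> j _.
    rewrite /= /ind Eb mulr1 -prodEFin.
    under eq_bigr do rewrite prob_value.
    apply: perm_big; apply: uniq_perm => //.
    by move=> x; rewrite inE.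
  have -> : pinned J b E = set0.
    apply/seteqP; split=> t // [tJ Et]; move: nEb; rewrite -(dE _ b tJ).
    by rewrite Et.
  by split=> //; rewrite measure0 /= /ind (negbTE nEb) mulr0.
have iJ : i \notin J by move: uJ => /= /andP[+ _]; rewrite mem_cat negb_or => /andP[].
have uiJ : uniq (l ++ i :: J).
  by rewrite (@perm_uniq _ _ (i :: l ++ J)) // perm_catC /= perm_cons perm_catC.
have diJ : depends (mem (l ++ i :: J)) E.
  by apply: dependsW dE => x; rewrite !(inE, mem_cat); case: eqP; rewrite //= orbT.
have [m1 p1] := IH (i :: J) (upd b i true) uiJ diJ.
have [m0 p0] := IH (i :: J) (upd b i false) uiJ diJ.
have splitE : pinned J b E =
    pinned (i :: J) (upd b i true) E `|` pinned (i :: J) (upd b i false) E.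
  apply/seteqP; split=> t /=.
    move=> [tJ Et]; case Zi : (Z i t); [left|right]; split=> // j;
      by rewrite inE /upd; case: eqP => [->|_ /tJ].
  move=> [] [tJ Et]; split=> // j jJ; have := tJ j; rewrite inE jJ orbT => /(_ isT);
    by rewrite /upd; case: eqP => // ji; rewrite -ji jJ in iJ.
have prodE x : \prod_(j <- J) bias j (upd b i x j) = \prod_(j <- J) bias j (b j).
  apply: eq_big_seq => j jJ; rewrite /upd; case: eqP => // ji.
  by rewrite -ji jJ in iJ.
rewrite splitE; split; first exact: measurableU.
rewrite measureU //; last first.
  apply/seteqP; split=> t // [] [t1 _] [t0 _].
  by have := t1 i (mem_head _ _); rewrite (t0 i (mem_head _ _)) /upd eqxx.
rewrite -[LHS]/(P (pinned (i :: J) (upd b i true) E) +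
                P (pinned (i :: J) (upd b i false) E))%E p1 p0 -EFinD; congr EFin.
by rewrite !big_cons !prodE /= /avg /upd !eqxx /=; ring.
Qed.

Lemma transfer l (E : (I -> bool) -> bool) w : uniq l -> depends (mem l) E ->
  measurable [set t | E (fun i => Z i t)] /\
  P [set t | E (fun i => Z i t)] = (mean q l (ind R E) w)%:E.
Proof.
move=> ul dE; have [||m p] := @pinned_prob l [::] w E; rewrite ?cats0 //.
have <- : pinned [::] w E = [set t | E (fun i => Z i t)].
  by apply/seteqP; split=> t /=; [case | split].
by split=> //; rewrite p big_nil mul1r.
Qed.

End Transfer.
(** * Enumerating the obstructions *)

Definition words n : seq (seq bool) := [seq tval u | u : n.-tuple bool].
Definition turnings n : seq (seq 'I_3) := [seq tval u | u : n.-tuple 'I_3].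

(** The empty circuit stands for a failure at the origin itself. *)
Definition barrier (ts : seq 'I_3) : seq site :=
  if ts is [::] then [:: (0, 0)%N] else blocking ts.

Definition long_barrier (ts : seq 'I_3) : bool :=
  (size ts <= 4 * size (barrier ts))%N.

(** The word prefixes and circuits of length n that can obstruct a word: the
    blocking sites have level at most 2 n, and a failure at level m looks
    at the letters with index at most 2 m. *)
Definition scenarios n : seq (seq bool * seq 'I_3) :=
  [seq (u, ts) | u <- words (4 * n).+1, ts <- [seq ts <- turnings n | long_barrier ts]].

Definition word_of (u : seq bool) : nat -> bool := nth false u.

Lemma settled_ext K L xi xi' c w :
  (forall k, (k <= (level c).*2)%N -> xi k = xi' k) ->
  settled K L xi c w = settled K L xi' c w.
Proof.
move: {2}(level c) (erefl (level c)) => m; elim: m c => [|m IH] c cm.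
  by move=> E; rewrite /settled cm /= E.
rewrite cm => E; rewrite !settledE ?cm // /entries cm !E; [|lia..].
have W : from_west K L xi c w = from_west K L xi' c w.
  rewrite /from_west; case: ltnP => // c1.
  have lm : level (west c) = m by move: cm; rewrite /level /=; lia.
  by apply: IH => // k; rewrite lm => km; apply: E; lia.
have S : from_south K L xi c w = from_south K L xi' c w.
  rewrite /from_south; case: ltnP => // c2.
  have lm : level (south c) = m by move: cm; rewrite /level /=; lia.
  by apply: IH => // k; rewrite lm => km; apply: E; lia.
by rewrite W S.
Qed.

Lemma failed_ext K L xi xi' c w :
  (forall k, (k <= (level c).*2)%N -> xi k = xi' k) ->
  failed K L xi c w = failed K L xi' c w.
Proof.
move=> E; rewrite /failed (settled_ext _ _ _ E).
have W : from_west K L xi c w = from_west K L xi' c w.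
  rewrite /from_west; case: ltnP => // c1; apply: settled_ext => k.
  by rewrite /level /= => kc; apply: E; rewrite /level; lia.
have S : from_south K L xi c w = from_south K L xi' c w.
  rewrite /from_south; case: ltnP => // c2; apply: settled_ext => k.
  by rewrite /level /= => kc; apply: E; rewrite /level; lia.
by rewrite W S.
Qed.

Lemma mem_words (u : seq bool) : u \in words (size u).
Proof. by apply/mapP; exists (in_tuple u); rewrite ?mem_enum. Qed.

Lemma mem_turnings (ts : seq 'I_3) : ts \in turnings (size ts).
Proof. by apply/mapP; exists (in_tuple ts); rewrite ?mem_enum. Qed.

Lemma blocking_level ts b : b \in blocking ts -> (level b <= (size ts).*2)%N.
Proof.
rewrite mem_undup => /mapP[s]; rewrite mem_filter => /andP[_ sts] ->.
by have := outer_level (s := origin_side) isT sts.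
Qed.

(** A finite set of settled sites is surrounded by failures: apply [contour] to
    it, unless the exploration fails at the origin.  The circuit is no longer
    than four times the number of cells in an n by n square. *)
Lemma dead_cluster K L xi w n :
  (forall c, settled K L xi c w -> (level c < n)%N) ->
  exists N, exists2 x, (N < (4 * n ^ 2).+1)%N /\ x \in scenarios N &
    all (fun c => failed K L (word_of x.1) c w) (barrier x.2).
Proof.
move=> fin; have [s0|ns0] := boolP (isSome (settled K L xi (0, 0)%N w)); last first.
  (* A failure at the origin only looks at the first letter. *)
  exists 0%N; exists ([:: xi 0%N], [::]).
    split=> //; apply/allpairsP; exists ([:: xi 0%N], [::]); split=> //.
      exact: mem_words.
    by rewrite mem_filter; apply/andP; split=> //; apply: (mem_turnings [::]).
  rewrite /= andbT (@failed_ext _ _ _ xi) /failed ?ns0 //.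
  by move=> [|k].
pose C (c : cell) := [&& 0 <= c.1, 0 <= c.2 & settled K L xi (abs_cell c) w : bool].
pose D : seq cell := [seq (i%:Z, j%:Z) | i <- iota 0 n, j <- iota 0 n].
have CD : {subset C <= D}.
  move=> [a b] /and3P[/= a0 b0 /fin]; rewrite /level /= => ab.
  apply/allpairsP; exists (absz a, absz b).
  by rewrite /= !mem_iota !gez0_abs //; split=> //; lia.
have Cpos c : C c -> 0 <= c.1 /\ 0 <= c.2 by move=> /and3P[].
have [|ts [/andP[ts0 tsD] lts bts]] := contour CD Cpos; first by rewrite /C s0.
have barE : barrier ts = blocking ts by case: ts ts0 {tsD lts bts}.
have sD : size D = (n ^ 2)%N by rewrite size_allpairs !size_iota.
exists (size ts); exists (mkseq xi (4 * size ts).+1, ts).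
  rewrite ltnS -sD; split=> //.
  apply/allpairsP; exists (mkseq xi (4 * size ts).+1, ts); split=> //=.
    by rewrite -{2}(size_mkseq xi (4 * size ts).+1); apply: mem_words.
  by rewrite mem_filter /long_barrier barE lts mem_turnings.
rewrite /= barE; apply/allP => b bb.
have bl := blocking_level bb.
rewrite (@failed_ext _ _ _ xi); last first.
  move=> k kb; rewrite /word_of nth_mkseq //.
  by move: (size ts) bl => m bl; lia.
have [nC par] := bts _ bb.
have nsb : ~~ settled K L xi b w.
  by move: nC; rewrite /C /abs_cell /=; case: (b).
rewrite /failed nsb andbT.
have parC (i j : int) : C (i, j) -> settled K L xi (absz i, absz j) w by move=> /and3P[].
case: par => Cp; apply/or3P; [apply: Or32 | apply: Or33].
  have /and3P[/= p1 _ _] := Cp; have := parC _ _ Cp.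
  rewrite /from_west ifT; last by lia.
  by rewrite /west; case: (b) p1 => i j /= p1; (have -> : absz (i%:Z - 1) = i.-1 by lia).
have /and3P[/= _ p2 _] := Cp; have := parC _ _ Cp.
rewrite /from_south ifT; last by lia.
by rewrite /south; case: (b) p2 => i j /= p2; (have -> : absz (j%:Z - 1) = j.-1 by lia).
Qed.

(** * Union bound over the obstructions *)

Section Obstructions.
Variables (R : realType) (K L : nat) (p eps : R) (pn : nat -> R).
Hypotheses (p01 : 0 < p < 1) (eps01 : 0 < eps <= 1)
  (pn01 : forall n, (1 <= n)%N -> 0 <= pn n <= 1).
Variables (disp : measure_display) (T : measurableType disp)
  (P : probability T R) (Z : coord -> {RV P >-> bool}).
Hypothesis indZ : mutually_independent Z.
Hypothesis PZ : forall i, P (Z i @^-1` [set true]) = (weight K p eps pn i)%:E.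

Notation failed := (failed K L).
Notation settled := (settled K L).
Notation delta := (delta K L p eps pn).

Definition config (t : T) : coord -> bool := fun i => Z i t.

(** The coordinates outside the columns of ys are averaged last, where the bound
    no longer depends on them. *)
Lemma prob_all_failed xi ys : uniq ys ->
  measurable [set t | all (fun c => failed xi c (config t)) ys] /\
  (P [set t | all (fun c => failed xi c (config t)) ys] <= (delta ^+ size ys)%:E)%E.
Proof.
move=> uys; pose M := \max_(c <- ys) level c.
have My c : c \in ys -> (level c <= M)%N by move=> cy; apply: (leq_bigmax_seq (F := level)).
pose H := (M.+1 * K).+1.
pose zs := sort (relpre level leq) ys.
have zy : zs =i ys by apply: mem_sort.
have zsH : {in zs, forall c, ((level c).+1 * K < H)%N}.
  by move=> c; rewrite zy => /My cM; rewrite ltnS leq_mul2r ltnS cM orbT.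
pose full := columns K H [seq (i, j) | i <- iota 0 M.+1, j <- iota 0 M.+1].
(* Enough coordinates to decide the event; those of the columns of zs are listed
   last, hence averaged first. *)
pose rest := [seq i <- full | i \notin columns K H zs].
pose l := rest ++ columns K H zs.
pose E (w : coord -> bool) := all (fun c => failed xi c w) zs.
have EE : [set t | all (fun c => failed xi c (config t)) ys] = [set t | E (fun i => Z i t)].
  by apply/seteqP; split=> t /=; rewrite /E (eq_all_r zy).
have uzs : uniq zs by rewrite sort_uniq.
have ul : uniq l.
  rewrite cat_uniq; apply/and3P; split; last exact: columns_uniq.
    apply: filter_uniq; apply: columns_uniq.
    by apply: allpairs_uniq; rewrite ?iota_uniq // => -[? ?] [? ?].
  by apply/hasPn => i izs /=; rewrite mem_filter izs.
have dE : depends (mem l) E.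
  move=> w w' ww; apply: eq_in_all => c cz.
  apply: (failed_depends L xi (zsH _ cz)) => i /and3P[i1 i2 iH]; apply: ww.
  have := My c; rewrite -zy => /(_ cz) cM.
  rewrite /= mem_cat mem_filter; case: (boolP (i \in columns K H zs)) => //= _.
  rewrite orbF mem_columns iH andbT; apply/allpairsP; exists i.1.
  rewrite !mem_iota !add0n !ltnS; split; last by case: (i.1).
    by apply: leq_trans i1 (leq_trans _ cM); apply: leq_addr.
  by apply: leq_trans i2 (leq_trans _ cM); apply: leq_addl.
have [mE pE] := transfer indZ PZ (fun=> true) ul dE.
rewrite EE; split=> //; rewrite pE lee_fin /l mean_cat.
rewrite -[leRHS](mean_cst (weight K p eps pn) rest _ (fun=> true)).
apply: mean_le => [i|w]; first exact: weight01.
have -> : size ys = size zs by rewrite size_sort.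
apply: mean_all_failed => //.
by apply: sort_sorted => c c'; exact: leq_total.
Qed.

Lemma measurable_big_union (A : eqType) (s : seq A) (F : A -> set T) :
  (forall x, x \in s -> measurable (F x)) ->
  measurable (\big[setU/set0]_(x <- s) F x).
Proof. by move=> mF; rewrite big_seq; apply: bigsetU_measurable. Qed.

Lemma union_bound (A : eqType) (s : seq A) (F : A -> set T) (b : A -> R) :
  (forall x, x \in s -> measurable (F x) /\ (P (F x) <= (b x)%:E)%E) ->
  (P (\big[setU/set0]_(x <- s) F x) <= (\sum_(x <- s) b x)%:E)%E.
Proof.
elim: s => [|x s IH] sF; first by rewrite !big_nil measure0.
have sF' y : y \in s -> measurable (F y) /\ (P (F y) <= (b y)%:E)%E.
  by move=> ys; apply: sF; rewrite inE ys orbT.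
have [mx px] := sF x (mem_head _ _).
rewrite !big_cons EFinD; apply: le_trans (leeD px (IH sF')).
by apply: measureU2 => //; apply: measurable_big_union => y /sF'[].
Qed.

Definition blocked (x : seq bool * seq 'I_3) : set T :=
  [set t | all (fun c => failed (word_of x.1) c (config t)) (barrier x.2)].

(** There are 2 * 48 ^ n scenarios, as 48 = 2 ^ 4 * 3; each has at least n / 4
    sites, hence probability at most theta ^ n when delta is at most
    theta ^ 4. *)
Lemma scenarios_sum (theta : R) n : 0 <= theta -> 48 * theta <= 2^-1 ->
  delta <= theta ^+ 4 ->
  \sum_(x <- scenarios n) delta ^+ size (barrier x.2) <=
  4 * (48 * theta) * 2^-1 ^+ n.
Proof.
move=> t0 t1 dt; have d0 : 0 <= delta by apply: delta_ge0.
have th1 : theta <= 1 by lra.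
apply: le_trans (_ : \sum_(x <- scenarios n) theta ^+ maxn n 1 <= _).
  rewrite !big_seq; apply: ler_sum => x /allpairsP[[u ts] [/= _ + ->]] /=.
  rewrite mem_filter => /andP[lts /mapP[u' _ tsE]].
  have sts : size ts = n by rewrite tsE size_tuple.
  apply: le_trans (_ : theta ^+ (4 * size (barrier ts)) <= _).
    by rewrite exprM; apply: lerXn2r => //; rewrite nnegrE ?exprn_ge0.
  apply: ler_wiXn2l => //.
  case: ts lts sts {tsE} => [|t ts] lts sts; first by rewrite -sts.
  by move: lts; rewrite /long_barrier sts (maxn_idPl _) // -sts.
have sz : (size (scenarios n) <= 2 * 48 ^ n)%N.
  rewrite size_allpairs size_map -cardE card_tuple card_bool.
  have -> : (2 * 48 ^ n = 2 ^ (4 * n).+1 * 3 ^ n)%N.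
    by rewrite expnS expnM -mulnA -expnMn.
  rewrite leq_mul2l; apply/orP; right.
  apply: leq_trans (size_subseq (filter_subseq _ _)) _.
  by rewrite size_map -cardE card_tuple card_ord.
rewrite big_const_seq count_predT iter_addr_0 -[_ *+ size _]mulr_natl.
apply: le_trans (_ : (2 * 48 ^ n)%:R * theta ^+ maxn n 1 <= _).
  by rewrite ler_wpM2r ?exprn_ge0 // ler_nat.
rewrite natrM natrX; case: n {sz} => [|n].
  by rewrite !expr0 expr1; lra.
have -> : maxn n.+1 1 = n.+1 by [].
rewrite -mulrA -exprMn !exprS.
have xy : (48 * theta) ^+ n <= 2^-1 ^+ n.
  by apply: lerXn2r; rewrite ?nnegrE ?mulr_ge0 //; lra.
have b0 : 0 <= 48 * theta by lra.
have := ler_wpM2l b0 xy.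
by move: (48 * theta * _) => x; lra.
Qed.
(** If some word fails before level n, then one of the scenarios below occurs.
    The bound on their total probability is uniform in n. *)
Definition obstructed n : set T :=
  \big[setU/set0]_(N <- iota 0 (4 * n ^ 2).+1)
    \big[setU/set0]_(x <- scenarios N) blocked x.

Lemma obstructed_prob theta n : 0 <= theta -> 48 * theta <= 2^-1 ->
  delta <= theta ^+ 4 ->
  measurable (obstructed n) /\ (P (obstructed n) <= (8 * (48 * theta))%:E)%E.
Proof.
move=> t0 t1 dt.
have one N : measurable (\big[setU/set0]_(x <- scenarios N) blocked x) /\
    (P (\big[setU/set0]_(x <- scenarios N) blocked x) <=
     (4 * (48 * theta) * 2^-1 ^+ N)%:E)%E.
  have bl x : measurable (blocked x) /\
      (P (blocked x) <= (delta ^+ size (barrier x.2))%:E)%E.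
    by apply: prob_all_failed; case: (x.2) => // t ts; apply: undup_uniq.
  split; first by apply: measurable_big_union => x _; case: (bl x).
  apply: le_trans (union_bound (fun x _ => bl x)) _.
  by rewrite lee_fin; apply: scenarios_sum.
split; first by apply: measurable_big_union => N _; case: (one N).
apply: le_trans (union_bound (fun N _ => one N)) _.
rewrite lee_fin; set M := (_.+1).
have -> : \sum_(N <- iota 0 M) 4 * (48 * theta) * 2^-1 ^+ N =
    8 * (48 * theta) * (1 - 2^-1 ^+ M).
  elim: M => [|M IH]; first by rewrite big_nil expr0; ring.
  have -> : iota 0 M.+1 = iota 0 M ++ [:: M] by rewrite -addn1 iotaD.
  by rewrite big_cat big_seq1 IH exprS /=; field.
rewrite ler_piMr ?mulr_ge0 // lerBlDr lerDl.
Qed.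

Lemma obstructedP n t :
  (exists N, exists2 x, (N < (4 * n ^ 2).+1)%N /\ x \in scenarios N &
    all (fun c => failed (word_of x.1) c (config t)) (barrier x.2)) ->
  obstructed n t.
Proof.
move=> [N [x [NM xN] xb]]; have iN : N \in iota 0 (4 * n ^ 2).+1 by rewrite mem_iota.
rewrite /obstructed -bigcup_seq; exists N; first exact: iN.
by rewrite -bigcup_seq; exists x.
Qed.
End Obstructions.

(** * Finite and infinite words *)

Section Words.
Variables (d K : nat).
Implicit Types (x : vertex d -> bool) (y : edge d -> bool) (xi : word)
  (v : vertex d) (e : edge d).

(** Paths are built from their start here: this form is the one to prolong step
    by step, and the recursion on n carries measurability. *)
Fixpoint ahead x y xi n v i : Prop :=
  if n is n'.+1 then
    exists e, [/\ source e = v, (edge_length e <= K)%N, y e,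
      x (target e) = xi i & ahead x y xi n' (target e) i.+1]
  else True.

Definition out_edges v : seq (edge d) :=
  [seq inl (v, i) | i <- enum 'I_d.-1] ++
  [seq inr (v, exist (fun n => (0 < n)%N) n.+1 (ltn0Sn n)) | n <- iota 0 K].

Lemma mem_out_edges e : (edge_length e <= K)%N -> e \in out_edges (source e).
Proof.
rewrite mem_cat; case: e => [[v i]|[v [[//|n] n0]]] /= eK; apply/orP; [left|right].
  by apply/mapP; exists i; rewrite ?mem_enum.
apply/mapP; exists n; first by rewrite mem_iota.
by congr (inr (_, _)); apply: val_inj.
Qed.

Lemma aheadS x y xi n v i : ahead x y xi n.+1 v i -> ahead x y xi n v i.
Proof.
elim: n v i => [//|n IH] v i [e [se eK ye xe /IH ae]].
by exists e; split.
Qed.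

Lemma ahead_le x y xi m n v i : (m <= n)%N -> ahead x y xi n v i ->
  ahead x y xi m v i.
Proof.
move=> /subnK <-; elim: (n - m)%N => [//|k IH]; rewrite addSn => /aheadS.
exact: IH.
Qed.

Lemma ahead_ext x y xi xi' n v i :
  (forall k, (k < i + n)%N -> xi k = xi' k) ->
  ahead x y xi n v i -> ahead x y xi' n v i.
Proof.
elim: n v i => [//|n IH] v i E [e [se eK ye xe ae]]; exists e; split=> //.
  by rewrite xe E //; lia.
by apply: IH ae => k ki; apply: E; lia.
Qed.

(** The compactness step: if each of the finitely many edges from v allowed
    only bounded continuations, so would v. *)
Lemma ahead_step x y xi v i : (forall n, ahead x y xi n v i) ->
  exists e, [/\ source e = v, (edge_length e <= K)%N, y e,
    x (target e) = xi i & forall n, ahead x y xi n (target e) i.+1].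
Proof.
move=> av; apply: contrapT => none.
have : forall e, exists n, e \in out_edges v -> y e -> x (target e) = xi i ->
    (edge_length e <= K)%N -> source e = v -> ~ ahead x y xi n (target e) i.+1.
  move=> e; apply: contrapT => H; apply: none; exists e.
  have H' n : [/\ source e = v, (edge_length e <= K)%N, y e,
      x (target e) = xi i & ahead x y xi n (target e) i.+1].
    apply: contrapT => nH; apply: H; exists n => *; move=> ae; apply: nH; by split.
  by split; [case: (H' 0%N)|case: (H' 0%N)|case: (H' 0%N)|case: (H' 0%N)|move=> n; case: (H' n)].
move=> /choice[f fP].
have [e [se eK ye xe ae]] := av (\max_(e <- out_edges v) f e).+1.
have ev : e \in out_edges v by rewrite -se mem_out_edges.
apply: (fP e ev ye xe eK se); apply: ahead_le ae.
exact: (leq_bigmax_seq (F := f)).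
Qed.

(** The same paths built from their end, as the exploration produces them. *)
Fixpoint reach x y xi k v : Prop :=
  if k is k'.+1 then
    exists e, [/\ reach x y xi k' (source e), target e = v,
      (edge_length e <= K)%N, y e & x v = xi k']
  else v = 0.

Lemma reach_ahead x y xi k n v :
  reach x y xi k v -> ahead x y xi n v k -> ahead x y xi (k + n) 0 0.
Proof.
elim: k n v => [|k IH] n v; first by move=> ->.
move=> [e [re te eK ye xv]] av; rewrite addSnnS.
by apply: IH re _; exists e; split=> //; rewrite te.
Qed.

(** The sum of the coordinates increases along every edge, so that oriented paths
    never visit a vertex twice. *)
Definition mass v : nat := (\sum_(j < d) v ord0 j)%N.

Lemma mass_basis i : (i < d)%N -> mass (Defs.basis d i) = 1%N.
Proof.
move=> id; rewrite /mass (bigD1 (Ordinal id)) //= mxE eqxx big1 // => j ji.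
by rewrite mxE (_ : (j == i :> nat) = false) //; apply/negbTE.
Qed.

Lemma massD u v : mass (u + v) = (mass u + mass v)%N.
Proof. by rewrite /mass -big_split; apply: eq_bigr => j _; rewrite mxE. Qed.

Hypothesis d0 : (0 < d)%N.

Lemma mass_target e : (mass (source e) < mass (target e))%N.
Proof.
case: e => [[u i]|[u [n n0]]] /=; rewrite massD -[ltnLHS]addn0 ltn_add2l.
  by rewrite mass_basis // (leq_trans (ltn_ord i)) // leq_pred.
case: n n0 => // n _; rewrite mulrS massD mass_basis //; by case: (d) d0.
Qed.

Lemma ahead_seen x y xi v : (forall n, ahead x y xi n v 0) ->
  seen_from K x y v xi.
Proof.
move=> av.
have : forall s : vertex d * nat, exists u,
    (forall n, ahead x y xi n s.1 s.2) ->
    (exists e, [/\ source e = s.1, target e = u, (edge_length e <= K)%N & y e]) /\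
    x u = xi s.2 /\ (forall n, ahead x y xi n u s.2.+1).
  move=> [u i] /=; have [au|nau] := pselect (forall n, ahead x y xi n u i).
    have [e [se eK ye xe ae]] := ahead_step au.
    by exists (target e) => _; split; [exists e|].
  by exists u => au.
move=> /choice[g gP].
pose s := fix s k := if k is k'.+1 then g (s k', k') else v.
have sa k : forall n, ahead x y xi n (s k) k.
  by elim: k => [//|k IH] n /=; case: (gP (s k, k) IH) => _ [_].
exists s; split=> //.
  have sm k : (mass (s k) < mass (s k.+1))%N.
    have [[e [/= se te _ _]] _] := gP (s k, k) (sa k).
    by have := mass_target e; rewrite se te.
  have mono i j : (i < j)%N -> (mass (s i) < mass (s j))%N.
    elim: j => // j IH; rewrite ltnS leq_eqVlt => /predU1P[->//|/IH h].
    exact: ltn_trans h (sm j).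
  move=> i j sij; have [ij|ji|//] := ltngtP i j.
    by have := mono _ _ ij; rewrite sij ltnn.
  by have := mono _ _ ji; rewrite sij ltnn.
by move=> i; have [ex [xs _]] := gP (s i, i) (sa i).
Qed.

Lemma seen_ahead x y xi v n : seen_from K x y v xi -> ahead x y xi n v 0.
Proof.
move=> [s [<- _ sP]]; elim: n (0%N) => [//|n IH] i.
have [[e [se te eK ye]] xs] := sP i.
by exists e; split=> //; rewrite te //; apply: IH.
Qed.

(** Finite words suffice: a path for an infinite word is built one step at a
    time among the vertices from which all prefixes of the remaining letters can be seen. *)
Lemma W0_fullP x y : W0 K x y = [set: word] <->
  forall n (u : n.-tuple bool), ahead x y (nth false u) n 0 0.
Proof.
split=> [full n u|fin].
  by apply: seen_ahead; have : [set: word] (nth false u) by []; rewrite -full.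
apply/seteqP; split=> xi // _; apply: ahead_seen => n.
have := fin n [tuple of mkseq xi n]; apply: ahead_ext => k kn.
by rewrite nth_mkseq.
Qed.

End Words.

Lemma ahead_measurable (disp : measure_display) (T : measurableType disp)
  (R : realType) (P : probability T R) (d K : nat)
  (X : vertex d -> {RV P >-> bool}) (Y : edge d -> {RV P >-> bool}) xi n v i :
  measurable [set t | ahead K (fun v => X v t) (fun e => Y e t) xi n v i].
Proof.
elim: n v i => [|n IH] v i; first exact: measurableT.
have mZ (Zb : {RV P >-> bool}) b : measurable (Zb @^-1` [set b]).
  by rewrite -[X in measurable X]setTI; exact: measurable_funP.
have -> : [set t | ahead K (fun v => X v t) (fun e => Y e t) xi n.+1 v i] =
    \bigcup_(e in [set` [seq e <- out_edges K v | (edge_length e <= K)%N]])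
      ((Y e @^-1` [set true] `&` X (target e) @^-1` [set xi i]) `&`
       [set t | ahead K (fun v => X v t) (fun e => Y e t) xi n (target e) i.+1]).
  apply/seteqP; split=> t /=.
    move=> [e [se eK ye xe ae]]; exists e => //=.
    by rewrite mem_filter eK -se mem_out_edges.
  move=> [e /=]; rewrite mem_filter => /andP[eK ev] [[ye xe] ae].
  exists e; split=> //; move: ev; rewrite mem_cat => /orP[] /mapP[z _ ->] //.
apply: fin_bigcup_measurable => [|e _]; first exact: finite_seq.
by apply: measurableI; [apply: measurableI; apply: mZ | apply: IH].
Qed.

(** * The columns inside the oriented graph *)

Lemma mutually_independent_inj (disp disp' : measure_display)
    (T : measurableType disp) (T' : measurableType disp') (R : realType)
    (P : probability T R) (I J : choiceType) (f : I -> J)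
    (Z : J -> {RV P >-> T'}) :
  injective f -> mutually_independent Z ->
  mutually_independent (fun i => Z (f i)).
Proof.
move=> finj indZ A B mB.
pose B' (j : J) : set T' := [set b | forall i, f i = j -> B i b].
have B'f i : B' (f i) = B i.
  apply/seteqP; split=> b /=; first exact.
  by move=> Bb i' /finj ->.
have := indZ [fset f i | i in A]%fset B'; rewrite big_imfset; last first.
  by move=> i i' _ _; apply: finj.
rewrite /=; under eq_bigr do rewrite B'f.
move=> <-; last by move=> j /imfsetP[i /= iA ->]; rewrite B'f; apply: mB.
congr (P _); apply/seteqP; split=> t /= tA j.
  by move=> /imfsetP[i /= iA ->]; rewrite B'f; apply: tA.
by move=> jA; rewrite -B'f; apply: tA; apply/imfsetP; exists j.
Qed.

Section Embedding.
Variable d : nat.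
Hypothesis hd : (3 <= d)%N.

(** The vertex at height h above the site c; the horizontal coordinates other
    than the first two are kept at 0. *)
Definition place (c : site) (h : nat) : vertex d :=
  \row_(k < d) (if k == 0%N :> nat then c.1 else if k == 1%N :> nat then c.2
                else if k == d.-1 :> nat then h else 0%N).

Lemma direction_proof (b : bool) : ((if b then 0 else 1) < d.-1)%N.
Proof. by case: b; case: (d) hd => [|[|[|]]]. Qed.

Definition direction b : 'I_d.-1 := Ordinal (direction_proof b).

Definition embed (i : coord) : vertex d + edge d :=
  match i with
  | (c, inl h) => inl (place c h)
  | (c, inr (inl (h, n))) =>
      inr (inr (place c h, exist (fun n => (0 < n)%N) n.+1 (ltn0Sn n)))
  | (c, inr (inr (b, h))) => inr (inl (place c h, direction b))
  end.

Lemma vertical_index : (d.-1 == 0)%N = false /\ (d.-1 == 1)%N = false.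
Proof. by case: (d) hd => [|[|[|]]]. Qed.

Lemma place_inj c c' h h' : place c h = place c' h' -> c = c' /\ h = h'.
Proof.
have [d0 d1 d2] : [/\ (0 < d)%N, (1 < d)%N & (d.-1 < d)%N] by split; move: hd; lia.
move=> /rowP E.
have := E (Ordinal d0); have := E (Ordinal d1); have := E (Ordinal d2).
have [v0 v1] := vertical_index; rewrite !mxE /= eqxx v0 v1.
by case: c c' {E} => [? ?] [? ?] /= -> -> ->.
Qed.

Lemma embed_inj : injective embed.
Proof.
move=> [c [h|[[h n]|[b h]]]] [c' [h'|[[h' n']|[b' h']]]] //=.
- by move=> [] /place_inj[-> ->].
- by move=> [] /place_inj[-> ->] ->.
- by move=> [] /place_inj[-> ->]; case: b; case: b'.
Qed.

Lemma place00 : place (0, 0)%N 0 = 0.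
Proof. by apply/rowP => k; rewrite !mxE /= !if_same. Qed.

Lemma place_rise c h n : place c h + Defs.basis d d.-1 *+ n = place c (h + n)%N.
Proof.
apply/rowP => k; rewrite mxE mulmxnE !mxE.
have d01 := vertical_index.
case: (eqVneq (k : nat) 0%N) => [->|k0]; first by rewrite eq_sym d01.1 mul0rn addr0.
case: (eqVneq (k : nat) 1%N) => [->|k1]; first by rewrite eq_sym d01.2 mul0rn addr0.
by case: eqP => _; rewrite ?mul0rn ?addr0 // natn.
Qed.

Lemma place_east i j h :
  place (i, j) h + Defs.basis d (direction true) = place (i.+1, j) h.
Proof.
apply/rowP => k; rewrite !mxE /=.
case: (eqVneq (k : nat) 0%N) => [_|k0]; first by rewrite -[RHS]addn1.
by rewrite addr0.
Qed.

Lemma place_north i j h :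
  place (i, j) h + Defs.basis d (direction false) = place (i, j.+1) h.
Proof.
apply/rowP => k; rewrite !mxE /=.
case: (eqVneq (k : nat) 0%N) => [->|k0]; first by rewrite addr0.
case: (eqVneq (k : nat) 1%N) => [_|k1]; first by rewrite -[RHS]addn1.
by rewrite addr0.
Qed.

Section Trace.
Variables (K L : nat) (x : vertex d -> bool) (y : edge d -> bool) (xi : word).

Definition restrict (i : coord) : bool :=
  match embed i with inl v => x v | inr e => y e end.

Lemma hit_reach a b c h n k : (n < K)%N -> hit a b c h n restrict ->
  reach K x y xi k (place c h) -> xi k = a ->
  x (place c (h + n.+1) + Defs.basis d (direction b)) = xi k.+1 ->
  reach K x y xi k.+2 (place c (h + n.+1) + Defs.basis d (direction b)).
Proof.
move=> nK /and3P[r /eqP l cr] rk xa xb.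
exists (inl (place c (h + n.+1), direction b)); split=> //=; last first.
  by case: n nK {r l cr xb}; case: (K).
exists (inr (place c h, exist (fun n => (0 < n)%N) n.+1 (ltn0Sn n))).
by split=> //=; rewrite ?place_rise // xa -l.
Qed.

Lemma settled_reach c h : settled K L xi c restrict = Some h ->
  reach K x y xi (level c).*2 (place c h).
Proof.
move: {2}(level c) (erefl (level c)) => m; elim: m c h => [|m IH] c h cm.
  rewrite /settled cm /=; case: ifP => // _ [<-].
  by case: c cm => [[|?] [|?]] // _; apply: place00.
rewrite settledE ?cm // => /settle_some[hG + _]; rewrite doubleS /= => lh.
move: hG; rewrite /entries cm /=.
case fw: from_west => [h'|].
  move: fw; rewrite /from_west; case: ltnP => // c1 sw.
  have lw : level (west c) = m by move: cm; rewrite /level /=; lia.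
  move=> /mem_exits[n [nK hn hE]].
  have E : place (west c) (h' + n.+1) + Defs.basis d (direction true) = place c h.
    by rewrite place_east hE; case: (c) c1 => -[].
  rewrite -E; apply: (hit_reach nK hn) => //; last by rewrite E.
  by rewrite -lw; apply: IH.
case fs: from_south => [h'|//].
move: fs; rewrite /from_south; case: ltnP => // c2 ss.
have ls : level (south c) = m by move: cm; rewrite /level /=; lia.
move=> /mem_exits[n [nK hn hE]].
have E : place (south c) (h' + n.+1) + Defs.basis d (direction false) = place c h.
  by rewrite place_north hE; case: (c) c2 => i [].
rewrite -E; apply: (hit_reach nK hn) => //; last by rewrite E.
by rewrite -ls; apply: IH.
Qed.

Lemma dead_levels n : ~ ahead K x y xi n 0 0 ->
  forall c, settled K L xi c restrict -> (level c < n)%N.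
Proof.
move=> dead c; case sc: settled => [h|//] _; rewrite ltnNge; apply/negP => nc.
have le : (n <= (level c).*2 + 0)%N by lia.
exact: dead (ahead_le le (reach_ahead (settled_reach sc) _)).
Qed.

End Trace.
End Embedding.

(** * Choice of the truncation *)

Section Thresholds.
Variables (R : realType) (p eps : R) (pn : nat -> R).
Hypotheses (p01 : 0 < p < 1) (eps01 : 0 < eps <= 1)
  (pn01 : forall n, (1 <= n)%N -> 0 <= pn n <= 1)
  (hsum : (\sum_(1 <= n <oo) (pn n)%:E)%E = +oo%E).

Lemma large_partial_sum (A : R) : exists K, A < \sum_(n < K) pn n.+1.
Proof.
apply: contrapT => none.
suff : (\sum_(1 <= n <oo) (pn n)%:E <= A%:E)%E by rewrite hsum leye_eq.
apply: lime_le.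
  by apply: is_cvg_nneseries => n n1 _; rewrite lee_fin; case/andP: (pn01 n1).
apply: nearW => n; rewrite sumEFin lee_fin leNgt; apply/negP => An.
apply: none; exists n.-1; move: An; case: n => [|n]; first by rewrite big_geq ?big_ord0.
by rewrite big_add1 big_mkord.
Qed.

(** An elementary substitute for bounding the product by exp (- sum). *)
Lemma prod_sum_le1 (a : nat -> R) n : (forall k, 0 <= a k <= 1) ->
  \prod_(k < n) (1 - a k) * (1 + \sum_(k < n) a k) <= 1.
Proof.
move=> a01; elim: n => [|n IH]; first by rewrite !big_ord0; lra.
rewrite !big_ord_recr /=; apply: le_trans IH.
rewrite -mulrA; apply: ler_wpM2l.
  by apply: prodr_ge0 => k _; have := a01 k; lra.
have S0 : 0 <= \sum_(k < n) a k by apply: sumr_ge0 => k _; case/andP: (a01 k).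
move: (\sum_(k < n) a k) S0 => S S0; have /andP[x0 x1] := a01 n.
move: (a n) x0 x1 => x x0 x1.
have : 0 <= x * S by rewrite mulr_ge0.
have : 0 <= x * x by rewrite mulr_ge0.
lra.
Qed.

Lemma scarcity_small (b : R) : 0 < b ->
  exists2 K, (1 <= K)%N & scarcity K p eps pn <= b.
Proof.
move=> b0; pose c := rarer p * eps / 2.
have /andP[r0 r1] := rarer01 p01; have /andP[e0 e1] := eps01.
have re0 : 0 < rarer p * eps by rewrite mulr_gt0.
have re1 : rarer p * eps <= 1 by rewrite mulr_ile1 // ltW.
have c0 : 0 < c by rewrite /c; lra.
have [K AK] := large_partial_sum (b^-1 / c).
have S0 : 0 < b^-1 / c by rewrite divr_gt0 ?invr_gt0.
exists K.
  by case: K AK => //; rewrite big_ord0 => /(lt_trans S0); rewrite ltxx.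
pose a n := c * pn n.+1.
have a01 n : 0 <= a n <= 1.
  have /andP[q0 q1] := pn01 (ltn0Sn n).
  rewrite /a mulr_ge0 ?(ltW c0) //= mulr_ile1 ?(ltW c0) // /c; lra.
have := prod_sum_le1 K a01.
have -> : \prod_(k < K) (1 - a k) = scarcity K p eps pn.
  by apply: eq_bigr => n _; rewrite /a /c; congr (1 - _); ring.
have scar0 : 0 <= scarcity K p eps pn by apply: scarcity_ge0.
rewrite -mulr_sumr => h.
have bS : b^-1 <= 1 + c * \sum_(k < K) pn k.+1.
  have : b^-1 / c * c < c * \sum_(k < K) pn k.+1 by rewrite mulrC ltr_pM2l.
  by rewrite divfK ?gt_eqF // => /ltW h'; lra.
have : scarcity K p eps pn * b^-1 <= 1 by apply: le_trans h; rewrite ler_wpM2l.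
by rewrite ler_pdivrMr // mul1r.
Qed.

Lemma delta_small (b : R) : 0 < b ->
  exists L K, (1 <= K)%N /\ delta K L p eps pn <= b.
Proof.
move=> b0; have /andP[l0 l1] := likelier01 p01.
have [L lL] : exists L, likelier p ^+ L <= b / 2.
  have b2 : 0 < b / 2 by rewrite divr_gt0.
  have ln : `|likelier p| < 1 by rewrite ger0_norm // ltW.
  have /cvgrPdist_le/(_ _ b2) [N _ HN] := cvg_expr ln.
  exists N; have := HN N (leqnn N); rewrite /= sub0r normrN ger0_norm //.
  by rewrite exprn_ge0 // ltW.
have c0 : 0 < b / 2 / (2 * 2 ^+ L) by rewrite !divr_gt0 // mulr_gt0 ?exprn_gt0.
have [K K1 sK] := scarcity_small c0.
exists L, K; split=> //; rewrite /delta.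
have : 2 * 2 ^+ L * scarcity K p eps pn <= b / 2.
  by rewrite mulrC -ler_pdivlMr // mulr_gt0 ?exprn_gt0.
lra.
Qed.

End Thresholds.

Lemma weight_embed (R : realType) (d : nat) (hd : (3 <= d)%N)
    (disp : measure_display) (T : measurableType disp) (P : probability T R)
    (p eps : R) (pn : nat -> R) (K : nat)
    (X : vertex d -> {RV P >-> bool}) (Y : edge d -> {RV P >-> bool}) i :
  truncated_model p eps pn K X Y ->
  P (letters_and_bonds X Y (embed hd i) @^-1` [set true]) =
  (weight K p eps pn i)%:E.
Proof.
move=> [_ PX PY]; case: i => [c [h|[[h n]|[b h]]]] /=.
- exact: PX.
- exact: PY.
- exact: PY.
Qed.

(** * All words are seen *)

Theorem theorem1 (R : realType) (d : nat) (pn : nat -> R)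
  (hd : (3 <= d)%N)
  (hpn : forall n : nat, (1 <= n)%N -> 0 <= pn n <= 1)
  (hsum : (\sum_(1 <= n <oo) (pn n)%:E)%E = +oo%E)
  (p eps alpha : R)
  (hp : 0 < p < 1) (heps : 0 < eps <= 1) (halpha : 0 < alpha) :
  exists2 K : nat, (1 <= K)%N &
    forall (disp : measure_display) (T : measurableType disp)
      (P : probability T R)
      (X : vertex d -> {RV P >-> bool}) (Y : edge d -> {RV P >-> bool}),
    truncated_model p eps pn K X Y ->
    let all_seen :=
      [set w : T | W0 K (fun v => X v w) (fun e => Y e w) = [set: word]] in
    measurable all_seen /\ ((1 - alpha)%:E < P all_seen)%E.
Proof.
have [/andP[p0 p1] /andP[e0 e1]] := (hp, heps).
(* Half of alpha is left as a margin; 8 * (48 * theta) bounds the probability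
   of an obstruction. *)
pose theta : R := Num.min (2^-1) (alpha / 16) / 48.
have t48 : 48 * theta = Num.min (2^-1) (alpha / 16) by rewrite /theta; field.
have m0 : 0 < Num.min (2^-1 : R) (alpha / 16) by rewrite lt_min; lra.
have theta0 : 0 < theta by rewrite /theta divr_gt0.
have t1 : 48 * theta <= 2^-1 by rewrite t48 ge_min lexx.
have t2 : 48 * theta <= alpha / 16 by rewrite t48 ge_min lexx orbT.
have [L [K [K1 dt]]] := delta_small hp heps hpn hsum (exprn_gt0 4 theta0).
exists K => // disp T P X Y model all_seen.
pose Z i := letters_and_bonds X Y (embed hd i).
have indZ : mutually_independent Z.
  by apply: mutually_independent_inj; [exact: embed_inj | case: model].
have PZ i : P (Z i @^-1` [set true]) = (weight K p eps pn i)%:E.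
  exact: weight_embed.
pose good n := [set t | forall u : n.-tuple bool,
  ahead K (fun v => X v t) (fun e => Y e t) (nth false u) n 0 0].
have d0 : (0 < d)%N by apply: (leq_trans _ hd).
have seenE : all_seen = \bigcap_n good n.
  apply/seteqP; split=> t /=.
    by move=> /(W0_fullP _ d0) tn n _; apply: tn.
  by move=> tn; apply/(W0_fullP _ d0) => n; apply: tn.
have mgood n : measurable (good n).
  have -> : good n = \bigcap_(u in [set: n.-tuple bool])
      [set t | ahead K (fun v => X v t) (fun e => Y e t) (nth false u) n 0 0].
    by apply/seteqP; split=> t /= tn u; [move=> _|]; apply: tn.
  apply: fin_bigcap_measurable => [|u _]; first exact: finite_finset.
  exact: ahead_measurable.
have mall : measurable all_seen by rewrite seenE; apply: bigcapT_measurable.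
split=> //.
have goodP n : ((1 - alpha / 2)%:E <= P (good n))%E.
  have [mo po] := obstructed_prob hp heps hpn indZ PZ n (ltW theta0) t1 dt.
  have : (P (~` good n) <= (alpha / 2)%:E)%E.
    apply: le_trans (_ : P (obstructed K L Z n) <= _)%E.
      apply: le_measure; rewrite ?inE //; first exact: measurableC.
      move=> t /existsNP[u nu]; apply: obstructedP.
      apply: (dead_cluster (xi := nth false u)) => c.
      have -> : config Z t =
          restrict hd (fun v => X v t) (fun e => Y e t).
        apply/funext => i; rewrite /config /restrict /Z.
        by case: (embed hd i).
      exact: dead_levels.
    by apply: le_trans po _; rewrite lee_fin; lra.
  rewrite probability_setC //.
  have -> : P (good n) = (fine (P (good n)))%:E by rewrite fineK ?fin_num_measure.
  by rewrite -EFinB !lee_fin; lra.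
have ni : nonincreasing_seq good.
  move=> m n mn; apply/subsetPset => t tn u.
  have := tn [tuple of mkseq (nth false u) n].
  move=> /(ahead_le mn); apply: ahead_ext => k km.
  by rewrite nth_mkseq // (leq_trans km).
have cv := nonincreasing_cvg_mu (mu := P) _ mgood (bigcapT_measurable mgood) ni.
apply: lt_le_trans (_ : (1 - alpha / 2)%:E <= _)%E.
  by rewrite lte_fin; lra.
rewrite seenE -(cvg_lim _ (cv _)) //; last first.
  by apply: le_lt_trans (probability_le1 _ _) _; rewrite ?ltry.
apply: lime_ge; last by apply: nearW => n; apply: goodP.
apply/cvg_ex; exists (P (\bigcap_n good n)); apply: cv.
by apply: le_lt_trans (probability_le1 _ _) _; rewrite ?ltry.
Qed.
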